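(* Let $\kappa$ be a strongly inaccessible cardinal, and suppose that $\diamondsuit(S)$ holds for some nonreflecting stationary subset $S$ of $\kappa$. Then there is a $\kappa$-Souslin tree that forces $\square(\kappa)$.
   Context: A stationary $S\subseteq\kappa$ is nonreflecting if for every $\alpha<\kappa$ of uncountable cofinality, $S\cap\alpha$ is not stationary in $\alpha$. $\diamondsuit(S)$ asserts the existence of $\langle A_\alpha\mid\alpha\in S\rangle$ such that for every $A\subseteq\kappa$ the set $\{\alpha\in S\mid A\cap\alpha=A_\alpha\}$ is stationary in $\kappa$. A $\kappa$-tree is a tree of height $\kappa$ all of whose levels have size $<\kappa$. A $\kappa$-Souslin tree is a $\kappa$-tree with no chains and no antichains of size $\kappa$; all $\kappa$-Souslin trees are understood to be normal, i.e. every node has $\kappa$ many extensions in the tree. A tree is viewed as a notion of forcing in which nodes higher in the tree are stronger; it forces a statement if the statement holds in every generic extension by it. For a set of ordinals $C$, $\mathrm{acc}(C)=\{\alpha\in C\mid \sup(C\cap\alpha)=\alpha>0\}$. $\square(\kappa)$ (Todorčević) asserts the existence of a sequence $\langle C_\alpha\mid\alpha<\kappa\rangle$ such that: each $C_\alpha$ is a closed subset of $\alpha$ with $\sup(C_\alpha)=\sup(\alpha)$; for all $\alpha<\kappa$ and $\beta\in\mathrm{acc}(C_\alpha)$, $C_\beta=C_\alpha\cap\beta$ (coherence); and for every club $D$ in $\kappa$ there is $\alpha\in\mathrm{acc}(D)$ with $D\cap\alpha\ne C_\alpha$ (unthreadability). *)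

(* Defs.v *)
From HB Require Import structures.
From mathcomp Require Import all_boot all_order.
From mathcomp Require Import all_classical.

Set Implicit Arguments.
Unset Strict Implicit.
Unset Printing Implicit Defensive.

Local Open Scope classical_set_scope.
Local Open Scope card_scope.

(* A cardinal kappa is represented by a well-ordered type K of order type
   kappa: the elements of K are the ordinals below kappa, and [below a] is the
   ordinal a regarded as the set of its elements. *)

Definition card_lt (X Y : Type) (A : set X) (B : set Y) : Prop :=
  (A #<= B) /\ ~ (B #<= A).

Section Ordinals.
Context (d : Order.disp_t) (K : orderType d).
Implicit Types (a b : K) (I C D S : set K).

Definition below a : set K := [set b | (b < a)%O].

(* In the definitions relative to a set [I], [I] is an initial segment of K:
   either [setT] (the ordinal kappa) or [below a] (the ordinal a < kappa). *)

Definition cofinal_in I C : Prop :=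
  C `<=` I /\ forall a, I a -> exists2 b, C b & (a <= b)%O.

(* sup (C \cap b) = b > 0 *)
Definition limit_point C b : Prop :=
  below b !=set0 /\ supremums (C `&` below b) b.

Definition club_in I D : Prop :=
  cofinal_in I D /\ forall b, I b -> limit_point D b -> D b.

Definition stationary_in I S : Prop :=
  forall D, club_in I D -> (S `&` D) !=set0.

Definition uncountable_cofinality a : Prop :=
  forall C, cofinal_in (below a) C -> ~ countable C.

Definition nonreflecting S : Prop :=
  forall a, uncountable_cofinality a ->
    ~ stationary_in (below a) (S `&` below a).

(* The values [A a] for a outside S are irrelevant. *)
Definition diamond S : Prop :=
  exists A : K -> set K, forall X : set K,
    stationary_in setT [set a | S a /\ X `&` below a = A a].

(* The order type of K is an initial ordinal, and as such it is an
   uncountable regular strong limit cardinal. *)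
Definition strongly_inaccessible : Prop :=
  [/\ well_founded (fun a b : K => (a < b)%O),
      forall a, card_lt (below a) [set: K],
      ~ countable [set: K],
      forall C, cofinal_in setT C -> C #= [set: K] &
      forall a, card_lt [set X : set K | X `<=` below a] [set: K]].

End Ordinals.

Section Trees.
Context (d : Order.disp_t) (K : orderType d).
Context (d' : Order.disp_t) (T : porderType d').
Implicit Types (s t : T) (A : set T).

Definition is_chain A : Prop := forall s t, A s -> A t -> (s >=< t)%O.

Definition is_antichain A : Prop :=
  forall s t, A s -> A t -> s <> t -> (s >< t)%O.

Definition is_tree : Prop :=
  well_founded (fun s t => (s < t)%O) /\
  forall t, is_chain [set s | (s < t)%O].

(* The predecessors of t have order type a. *)
Definition has_height t (a : K) : Prop :=
  exists f : T -> K, set_bij [set s | (s < t)%O] (below a) f /\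
    forall s s', (s < t)%O -> (s' < t)%O -> (s < s')%O -> (f s < f s')%O.

Definition level (a : K) : set T := [set t | has_height t a].

Definition kappa_tree : Prop :=
  [/\ is_tree,
      forall t, exists a, has_height t a,
      forall a, level a !=set0 &
      forall a, card_lt (level a) [set: K]].

Definition normal_tree : Prop :=
  forall t, [set s | (t < s)%O] #= [set: K].

Definition souslin_tree : Prop :=
  [/\ kappa_tree,
      forall A, is_chain A -> ~ (A #= [set: K]),
      forall A, is_antichain A -> ~ (A #= [set: K]) &
      normal_tree].

End Trees.
Arguments souslin_tree {d} K {d'} T.

(* Forcing with a partial order T, where [p <= q] means that q is the stronger
   condition. [Name I elt cond] is the T-name {(elt i, cond i) | i in I}. *)
Inductive name (T : Type) : Type :=
  Name (I : Type) (elt : I -> name T) (cond : I -> T).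

Declare Scope forcing_scope.
Delimit Scope forcing_scope with forcing.

Section ForcingRelation.
Context (d' : Order.disp_t) (T : porderType d').

(* A statement of the forcing language is identified with the set of the
   conditions that force it. *)
Definition fstatement : Type := T -> Prop.
Implicit Types (phi psi : fstatement) (x y : name T) (p q r : T).

Definition dense_above p (U : T -> Prop) : Prop :=
  forall q, (p <= q)%O -> exists2 r, (q <= r)%O & U r.

(* p forces x = y iff, for every (z, s) in x and every q stronger than both p
   and s, q forces z \in y (see [f_mem] below), and symmetrically. *)
Fixpoint f_eq x : name T -> fstatement := fun y p =>
  let: Name _ u a := x in
  let: Name _ v b := y in
  (forall i q, (p <= q)%O -> (a i <= q)%O ->
     dense_above q (fun r => exists j, (b j <= r)%O /\ f_eq (u i) (v j) r)) /\
  (forall j q, (p <= q)%O -> (b j <= q)%O ->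
     dense_above q (fun r => exists i, (a i <= r)%O /\ f_eq (u i) (v j) r)).

Definition f_mem x y : fstatement := fun p =>
  let: Name _ v b := y in
  dense_above p (fun r => exists j, (b j <= r)%O /\ f_eq x (v j) r).

Definition f_not phi : fstatement := fun p => forall q, (p <= q)%O -> ~ phi q.

Definition f_and phi psi : fstatement := fun p => phi p /\ psi p.

Definition f_or phi psi : fstatement := fun p =>
  dense_above p (fun r => phi r \/ psi r).

Definition f_imp phi psi : fstatement := fun p =>
  forall q, (p <= q)%O -> phi q -> psi q.

Definition f_iff phi psi : fstatement := f_and (f_imp phi psi) (f_imp psi phi).

Definition f_all (phi : name T -> fstatement) : fstatement := fun p =>
  forall x, phi x p.

Definition f_ex (phi : name T -> fstatement) : fstatement := fun p =>
  dense_above p (fun r => exists x, phi x r).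

(* True in every generic extension: forced by every condition. *)
Definition forced phi : Prop := forall p, phi p.

End ForcingRelation.

Notation "x ∈ y" := (f_mem x y) (at level 70, no associativity)
  : forcing_scope.
Notation "x ≡ y" := (f_eq x y) (at level 70, no associativity)
  : forcing_scope.
Notation "¬ φ" := (f_not φ) (at level 75, right associativity)
  : forcing_scope.
Notation "φ ∧ ψ" := (f_and φ ψ) (at level 80, right associativity)
  : forcing_scope.
Notation "φ ∨ ψ" := (f_or φ ψ) (at level 85, right associativity)
  : forcing_scope.
Notation "φ ⇒ ψ" := (f_imp φ ψ) (at level 99, right associativity)
  : forcing_scope.
Notation "φ ⇔ ψ" := (f_iff φ ψ) (at level 95, no associativity)
  : forcing_scope.
Notation "∀ x , φ" := (f_all (fun x => φ%forcing))
  (at level 200, x binder, right associativity) : forcing_scope.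
Notation "∃ x , φ" := (f_ex (fun x => φ%forcing))
  (at level 200, x binder, right associativity) : forcing_scope.

Section SquareInTheExtension.
Context (d' : Order.disp_t) (T : porderType d').
Implicit Types (a b c k u x y z w D : name T).
Local Notation fstatement := (fstatement T).
Local Open Scope forcing_scope.

Definition f_upair z x y : fstatement := ∀ w, w ∈ z ⇔ w ≡ x ∨ w ≡ y.

(* u is the Kuratowski pair {{x}, {x, y}} *)
Definition f_pair u x y : fstatement :=
  ∀ z, z ∈ u ⇔ f_upair z x x ∨ f_upair z x y.

Definition f_app c a x : fstatement := ∃ u, u ∈ c ∧ f_pair u a x.

Definition f_function_on c k : fstatement :=
  (∀ u, u ∈ c ⇒ ∃ a, a ∈ k ∧ ∃ x, f_pair u a x) ∧
  (∀ a, a ∈ k ⇒ ∃ x, f_app c a x ∧ ∀ y, f_app c a y ⇒ y ≡ x).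

Definition f_subset x y : fstatement := ∀ z, z ∈ x ⇒ z ∈ y.

Definition f_is_cap z x y : fstatement := ∀ w, w ∈ z ⇔ w ∈ x ∧ w ∈ y.

Definition f_in_union z x : fstatement := ∃ y, y ∈ x ∧ z ∈ y.

(* sup x = sup y, the supremum of a set of ordinals being its union *)
Definition f_same_sup x y : fstatement :=
  ∀ z, f_in_union z x ⇔ f_in_union z y.

(* sup (x ∩ b) = b > 0 *)
Definition f_limit_point x b : fstatement :=
  (∃ z, z ∈ b) ∧ ∃ y, f_is_cap y x b ∧ ∀ z, f_in_union z y ⇔ z ∈ b.

Definition f_acc x b : fstatement := b ∈ x ∧ f_limit_point x b.

Definition f_closed_subset x a : fstatement :=
  f_subset x a ∧ ∀ b, b ∈ a ⇒ f_limit_point x b ⇒ b ∈ x.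

Definition f_club D k : fstatement :=
  f_closed_subset D k ∧ ∀ a, a ∈ k ⇒ ∃ b, b ∈ D ∧ a ∈ b.

Definition f_square_sequence k c : fstatement :=
  f_function_on c k ∧
  (∀ a, a ∈ k ⇒ ∀ x, f_app c a x ⇒ f_closed_subset x a ∧ f_same_sup x a) ∧
  (∀ a, a ∈ k ⇒ ∀ x, f_app c a x ⇒ ∀ b, f_acc x b ⇒
     ∀ y, f_app c b y ⇒ f_is_cap y x b) ∧
  (∀ D, f_club D k ⇒
     ∃ a, f_acc D a ∧ ∃ x, f_app c a x ∧ ¬ f_is_cap x D a).

Definition f_square k : fstatement := ∃ c, f_square_sequence k c.

End SquareInTheExtension.

Section CheckNames.
Context (d : Order.disp_t) (K : orderType d).
Context (d' : Order.disp_t) (T : porderType d').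
Local Notation ltK := (fun a b : K => (a < b)%O).

(* The canonical name of a as a von Neumann ordinal, in which the name of every
   b < a is paired with every condition (T need not have a weakest one). *)
Fixpoint ord_name (a : K) (acc_a : Acc ltK a) {struct acc_a} : name T :=
  Name (fun bp : {b : K | (b < a)%O} * T =>
          ord_name (Acc_inv acc_a (svalP bp.1)))
       snd.

Definition kappa_name (wfK : well_founded ltK) : name T :=
  Name (fun ap : K * T => ord_name (wfK ap.1)) snd.

Definition forces_square : Prop :=
  exists wfK : well_founded ltK, forced (f_square (kappa_name wfK)).

End CheckNames.
Arguments forces_square {d} K {d'} T.

(* Main.v *)
(* The nodes of the tree are coherent C-sequences <C_b | b <= a>, ordered by end
   extension, so that the union of a generic branch is a coherent C-sequence of
   length kappa. At every limit level a outside S, each branch through the tree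
   below a is continued by each of its threads. At a level a in S a branch is
   continued only if it decides the set of nodes guessed by the diamond sequence
   at a: some node of the branch lies in that set, or has no extension in it.

   Every node extends to every level a: by nonreflection there is a club in a
   without limit points in S, and one climbs along it, using at limit stages the
   part of the club already climbed as the value of the C-sequence. Hence the tree
   has height kappa, and guessing a set U of nodes on the club of closure points
   shows that at some level every node lies above an element of U or above a
   node with no extension in U. Applied to an antichain, or to the complement of
   the downward closure of a chain, this is the Souslin property.

   For unthreadability, let p force D to be club. At a closure point a of
   cofinality omega there is a node r above p at level a forcing D to be unbounded
   in a and to contain some b0 < a; as C_a may be any cofinal sequence of type
   omega, it can be chosen to omit b0, and then r forces that C_a is not D below
   a. *)
Require Import Defs.
From HB Require Import structures.
From mathcomp Require Import all_boot all_order.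
From mathcomp Require Import all_classical.

Set Implicit Arguments.
Unset Strict Implicit.
Unset Printing Implicit Defensive.

Import Order.TTheory.

Local Open Scope classical_set_scope.
Local Open Scope card_scope.

(** * Ordinals below kappa and small sets *)

Lemma set_inj_card_le (X Y : Type) (A : set X) (B : set Y) (f : X -> Y) :
  set_fun A B f -> set_inj A f -> A #<= B.
Proof.
move=> fAB finj; apply: card_le_trans (subset_card_le (image_subP.2 fAB)).
by have /card_eqPle[] := inj_card_eq (A := A) (f := f) finj.
Qed.

Lemma card_le_set_inj (X Y : Type) (y0 : Y) (A : set X) (B : set Y) :
  A #<= B -> exists f : X -> Y, set_fun A B f /\ set_inj A f.
Proof.
move=> /card_leP[f].
pose g x := if pselect (A x) is left Ax then val (f (SigSub (mem_set Ax))) else y0.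
exists g; split=> [x Ax|x y /set_mem Ax /set_mem Ay]; rewrite /g.
  by case: pselect => // {}Ax; exact: set_valP.
case: pselect => // {}Ax; case: pselect => // {}Ay.
by move=> /val_inj /(@inj _ _ _ f); rewrite !in_setT => /(_ isT isT) [].
Qed.

Section WellOrder.
Context (d : Order.disp_t) (K : orderType d).
Implicit Types (a b c : K) (C D S : set K).

Lemma limit_pointP C a :
  limit_point C a <->
  below a !=set0 /\ forall b, (b < a)%O -> exists2 c, C c & (b < c < a)%O.
Proof.
split=> -[a0 lim]; split=> //.
  move=> b ba; apply: contrapT => nex; case: lim => _ /(_ b).
  rewrite leNgt ba; apply: contraPP => _; apply/not_implyP; split=> //.
  move=> c [Cc ca]; rewrite leNgt; apply/negP => bc; apply: nex.
  by exists c => //; rewrite bc.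
split=> [c [_ /ltW]//|b ub]; rewrite leNgt; apply/negP => /lim[c Cc /andP[bc ca]].
by have := ub c (conj Cc ca); rewrite leNgt bc.
Qed.

Hypothesis wfK : well_founded (fun a b => (a < b)%O).

Lemma ex_least C : C !=set0 -> exists2 a, C a & forall b, C b -> (a <= b)%O.
Proof.
move=> [a0 Ca0]; apply: contrapT => nex.
suff: forall a, ~ C a by move/(_ a0).
move=> a; elim/(well_founded_ind wfK): a => a IH Ca; apply: nex; exists a => // b Cb.
by rewrite leNgt; apply/negP => /IH.
Qed.

(** No term lies strictly between [u n] and [u n.+1], so b, being at most some term, is not
    approached by terms from below. Coherence is therefore vacuous for values of type omega. *)
Lemma range_no_limit a (u : nat -> K) :
  {homo u : m n / (m <= n)%N >-> (m <= n)%O} ->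
  cofinal_in (below a) (range u) ->
  forall b, (b < a)%O -> ~ limit_point (range u) b.
Proof.
move=> u_homo [_ u_cof] b ba /limit_pointP[[c cb] lim].
have [_ [n _ <-]] := u_cof _ ba; elim: n => [|n IHn] bu.
  have [_ [m _ <-] /andP[_ umb]] := lim _ cb.
  by have := lt_le_trans umb bu; rewrite ltNge u_homo.
have [/IHn//|unb] := leP b (u n).
have [_ [m _ <-] /andP[unm umb]] := lim _ unb.
have [mn|nm] := leqP m n; first by rewrite ltNge u_homo in unm.
by have := lt_le_trans umb bu; rewrite ltNge u_homo.
Qed.

Lemma range_club a (u : nat -> K) :
  {homo u : m n / (m <= n)%N >-> (m <= n)%O} ->
  cofinal_in (below a) (range u) -> club_in (below a) (range u).
Proof.
by move=> u_homo u_cof; split=> // b /(range_no_limit u_homo u_cof).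
Qed.

(** Serves the ordinals about which nonreflection says nothing: zero, successors and ordinals of
    cofinality omega. *)
Lemma countable_cofinal_club a C : cofinal_in (below a) C -> countable C ->
  exists E, club_in (below a) E /\ forall b, (b < a)%O -> ~ limit_point E b.
Proof.
move=> [Ca C_cof] /pfcard_geP[C0|[f]].
  have a0 b : ~ (b < a)%O by move=> /C_cof[c]; rewrite C0.
  exists set0; split; last by move=> b /a0.
  by split; [split=> [b []|b /a0]|move=> b /a0].
have Cf n : C (f n) by exact: funS.
(* Running maxima of the enumeration [f]. They may become constant, which happens when a is a
   successor. *)
pose u := fix u n := if n is m.+1 then Order.max (u m) (f n) else f 0.
have u_homo : {homo u : m n / (m <= n)%N >-> (m <= n)%O}.
  by apply: homo_leq => // [? ? ? /le_trans|n]; [apply|rewrite /= le_max lexx].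
have u_cof : cofinal_in (below a) (range u).
  split=> [_ [n _ <-]|b /C_cof[c Cc bc]].
    by elim: n => /= [|n IHn]; [|rewrite /below /= gt_max [(_ < _)%O]IHn]; apply: Ca.
  have [n _ fn] := 'surj_f Cc.
  exists (u n); first by exists n.
  by rewrite (le_trans bc)// -fn; case: n {fn} => //= n; rewrite le_max lexx orbT.
exists (range u); split; first exact: range_club.
exact: range_no_limit.
Qed.

(** A strictly increasing map on a well-order satisfies [b <= g b], so a' < a would give a' <=
    [g a'] < a'. *)
Lemma strict_homo_ge a a' (g : K -> K) :
  (forall b, (b < a)%O -> (g b < a')%O) ->
  (forall b c, (b < c)%O -> (c < a)%O -> (g b < g c)%O) -> (a <= a')%O.
Proof.
move=> g_lt g_homo; rewrite leNgt; apply/negP => a'a.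
suff: forall b, (b < a)%O -> (b <= g b)%O.
  by move=> /(_ _ a'a); rewrite leNgt g_lt.
move=> b; elim/(well_founded_ind wfK): b => b IH ba; rewrite leNgt; apply/negP => gb.
by have := IH _ gb (lt_trans gb ba); rewrite leNgt g_homo.
Qed.

End WellOrder.

(** * Regularity and the strong limit property *)

Section Inaccessible.
Context (d : Order.disp_t) (K : orderType d).
Hypothesis K_inaccessible : strongly_inaccessible K.
Implicit Types (a b c : K) (C D S : set K).

Let wfK : well_founded (fun a b : K => (a < b)%O).
Proof. by case: K_inaccessible. Qed.

Lemma inaccessible_inhabited : exists a : K, True.
Proof.
have [_ _ K_unc _ _] := K_inaccessible; apply: contrapT => nK; apply: K_unc.
suff -> : [set: K] = set0 by exact: countable0.
by apply/seteqP; split=> // a _; apply: nK; exists a.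
Qed.

Lemma bounded_image X (A : set X) (f : X -> K) :
  ~ ([set: K] #<= A) -> exists a, forall x, A x -> (f x < a)%O.
Proof.
move=> KA; apply: contrapT => nb; have [_ _ _ K_reg _] := K_inaccessible.
have : cofinal_in setT (f @` A).
  split=> // a _; apply: contrapT => nc; apply: nb; exists a => x Ax.
  by rewrite ltNge; apply/negP => afx; apply: nc; exists (f x) => //; exists x.
by move=> /K_reg; rewrite card_eq_sym =>
  /card_eqPle[/card_le_trans/(_ (card_image_le f A))].
Qed.

Lemma bounded_range_nat (u : nat -> K) : exists a, forall n, (u n < a)%O.
Proof.
have [|a ua] := @bounded_image _ [set: nat] u; last by exists a => n; exact: ua.
by have [_ _ K_unc _ _] := K_inaccessible.
Qed.

Lemma ex_gt a : exists b, (a < b)%O.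
Proof. by have [b] := bounded_range_nat (fun=> a); exists b; exact: (_ 0). Qed.

Lemma ex_ub2 a b : exists c, (a < c)%O /\ (b < c)%O.
Proof.
have [c cP] := bounded_range_nat (fun n => if n is 0 then a else b).
by exists c; split; [exact: (cP 0)|exact: (cP 1)].
Qed.

(** A form of having size below kappa that passes directly along injections; [small_card_lt] relates
    it to [card_lt]. *)
Definition small X (A : set X) : Prop :=
  exists (b : K) (f : X -> K), (forall x, A x -> (f x < b)%O) /\ set_inj A f.

Lemma small_card_lt X (A : set X) : small A <-> card_lt A [set: K].
Proof.
have [_ K_init _ _ _] := K_inaccessible; have [k0 _] := inaccessible_inhabited.
split=> [[b [f [fb finj]]]|[/(card_le_set_inj k0)[f [_ finj]] /(bounded_image f)[b
  fb]]].
  have Ab : A #<= below b by exact: (@set_inj_card_le _ _ _ _ f).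
  have [bK Kb] := K_init b; split; first exact: card_le_trans Ab bK.
  by move=> /card_le_trans/(_ Ab).
by exists b, f.
Qed.

Lemma small_inj X Y (A : set X) (B : set Y) (f : X -> Y) :
  set_fun A B f -> set_inj A f -> small B -> small A.
Proof.
move=> fAB finj [b [g [gb ginj]]]; exists b, (g \o f); split=> [x /fAB/gb//|].
move=> x y Ax Ay /ginj fxy; apply: finj => //.
by apply: fxy; apply/mem_set/fAB/set_mem.
Qed.

Lemma small_below a : small (below a).
Proof. by exists a, id; split=> // ? ? _ _. Qed.

Lemma small_bounded X (A : set X) (f : X -> K) :
  small A -> exists a, forall x, A x -> (f x < a)%O.
Proof. by move=> /small_card_lt[_]; exact: bounded_image. Qed.

Lemma small_powerset X (A : set X) : small A -> small [set B : set X | B `<=` A].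
Proof.
move=> [b [f [fb finj]]]; have [_ _ _ _ K_lim] := K_inaccessible.
have /small_card_lt := K_lim b; apply: (@small_inj _ _ _ _ (image^~ f)).
  by move=> B BA _ [x /BA/fb fx <-].
move=> B C /set_mem BA /set_mem CA /seteqP[BC CB].
apply/seteqP; split=> x Bx.
  have [y Cy /finj <-//] := BC (f x) (ex_intro2 _ _ x Bx erefl); apply/mem_set;
    by [apply: CA|apply: BA].
have [y Cy /finj <-//] := CB (f x) (ex_intro2 _ _ x Bx erefl); apply/mem_set;
  by [apply: BA|apply: CA].
Qed.

Lemma unbounded_card C : (forall a, exists2 b, C b & (a <= b)%O) -> C #= [set: K].
Proof. by move=> C_cof; have [_ _ _ K_reg _] := K_inaccessible; apply: K_reg;
  split=> // a _. Qed.

(* The fibers are sent to consecutive blocks of kappa. *)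
Lemma small_fibers_inj X (A : set X) (r : X -> K) :
  (forall a, small (A `&` [set x | r x = a])) ->
  exists f : X -> K, set_inj A f.
Proof.
move=> r_small; have [k0 _] := inaccessible_inhabited.
have block a b : exists f : X -> K, set_inj (A `&` [set x | r x = a]) f /\
   forall x, (b <= f x)%O.
  have /small_card_lt[rK _] := r_small a.
  have : [set: K] #<= [set c | (b <= c)%O].
    have /card_eqPle[] // : [set c | (b <= c)%O] #= [set: K].
    by apply: unbounded_card => c; exists (Order.max b c); rewrite /= le_max lexx ?orbT.
  move=> /(card_le_trans rK)/(card_le_set_inj b)[f [fb finj]].
  exists (fun x => if pselect (A x /\ r x = a) then f x else b); split.
    move=> x y /[dup] Ax /set_mem Ax' /[dup] Ay /set_mem Ay'.
    by case: pselect => // ?; case: pselect => // ?; exact: finj.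
  by move=> x; case: pselect => // Ax; exact: fb.
have {block} /choice[f fP] : forall ab : K * K, exists f : X -> K,
    set_inj (A `&` [set x | r x = ab.1]) f /\ forall x, (ab.2 <= f x)%O.
  by move=> [a b]; exact: block.
have ub ab : exists c, forall x, (A `&` [set x | r x = ab.1]) x -> (f ab x < c)%O.
  exact: small_bounded.
have {ub} /choice[B BP] := ub.
(* Recursive choice of the point [g a] where the block of a starts: [B (a', g a')] bounds the block
   of a', and by regularity some ordinal exceeds these bounds for all a' < a. *)
pose gP a (rec : forall a', (a' < a)%O -> K) b :=
  forall a' (lt_a'a : (a' < a)%O), (B (a', rec a' lt_a'a) < b)%O.
have gP_ex a rec : exists b, gP a rec b.
  pose h a' := if pselect (a' < a)%O is left lt_a'a then B (a', rec a' lt_a'a) else k0.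
  have [b hb] := small_bounded h (small_below a).
  exists b => a' lt_a'a; have := hb a' lt_a'a; rewrite /h; case: pselect => // lt'.
  by rewrite (Prop_irrelevance lt' lt_a'a).
pose F a rec := sval (cid (gP_ex a rec)).
pose g := Fix wfK (fun=> K) F.
have gE a a' : (a' < a)%O -> (B (a', g a') < g a)%O.
  have -> : g a = F a (fun a' _ => g a').
    by rewrite /g Fix_eq// => x r1 r2 r12; congr F;
      do 2!apply: functional_extensionality_dep => ?.
  by move=> lt_a'a; exact: (svalP (cid (gP_ex a (fun a' _ => g a'))) a' lt_a'a).
exists (fun x => f (r x, g (r x)) x) => x y /set_mem Ax /set_mem Ay fxy.
have lt_f x' y' : A x' -> A y' -> (r x' < r y')%O ->
    (f (r x', g (r x')) x' < f (r y', g (r y')) y')%O.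
  move=> Ax' _ /gE; move/lt_le_trans => /(_ _ ((fP (r y', g (r y'))).2 y')).
  by apply: lt_trans; exact: (BP (_, _)).
case: (ltgtP (r x) (r y)) => [/(lt_f _ _ Ax Ay)|/(lt_f _ _ Ay Ax)|rxy].
- by rewrite fxy ltxx.
- by rewrite fxy ltxx.
- move: fxy; rewrite -rxy; apply: (fP (r x, _)).1; exact/mem_set.
Qed.

Section ClosurePoints.
Variable h : K -> K.

Definition closure_point a := below a !=set0 /\ forall b, (b < a)%O -> (h b < a)%O.

Hypothesis h_gt : forall a, (a < h a)%O.

(** Iterate [h] from [a0] and let a be the supremum. The sequence is returned together with a
    because [generic_limit] climbs along it. *)
Lemma closure_point_sup a0 : exists (u : nat -> K) (a : K),
  [/\ u 0 = a0, forall n, (h (u n) <= u n.+1)%O,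
      {homo u : m n / (m <= n)%N >-> (m <= n)%O},
      cofinal_in (below a) (range u) &
      (forall b c, (b <= c)%O -> (h b <= h c)%O) -> closure_point a].
Proof.
pose u n := iter n h a0.
have u_lt n : (u n < u n.+1)%O by exact: h_gt.
have u_homo : {homo u : m n / (m <= n)%N >-> (m <= n)%O}.
  by apply: homo_leq => // [? ? ? /le_trans|n]; [apply|exact/ltW].
have [a ua amin] := ex_least wfK (bounded_range_nat u).
have u_cof : cofinal_in (below a) (range u).
  split=> [_ [n _ <-]|b ba]; first exact: ua.
  apply: contrapT => nex; move: ba; rewrite /below /= ltNge => /negP; apply;
    apply: amin => n.
  by rewrite ltNge; apply/negP => bu; apply: nex; exists (u n) => //; exists n.
exists u, a; split=> // h_homo; split=> [|b /u_cof.2[_ [n _ <-] /h_homo bu]].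
  by exists (u 0); exact: ua.
exact: (le_lt_trans bu (ua n.+1)).
Qed.

Lemma closure_point_club : (forall b c, (b <= c)%O -> (h b <= h c)%O) ->
  club_in setT closure_point.
Proof.
move=> h_homo; split; first split=> // a _.
  have [u [b [u0 _ _ [ub _] /(_ h_homo) hb]]] := closure_point_sup a.
  by exists b => //; apply: ltW; apply: ub; exists 0.
move=> a _ /limit_pointP[a0 lim]; split=> // b /lim[c [_ hc] /andP[bc ca]].
exact: lt_trans (hc _ bc) ca.
Qed.

End ClosurePoints.

End Inaccessible.

(** * The tree *)

(* The sequence <cs t b | b <= ht t>, with the junk value set0 above ht t. *)
Record node (d : Order.disp_t) (K : orderType d) :=
  Node { ht : K; cs : K -> set K }.

Section Nodes.
Context (d : Order.disp_t) (K : orderType d).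
Implicit Types (a b c : K) (C D S : set K) (s t u z w : node K).

(** The first clause fixes the junk values, so that a node is determined by its values up to its
    height and [ext] is antisymmetric. *)
Definition coherent t : Prop :=
  [/\ forall b, (ht t < b)%O -> cs t b = set0,
      forall b, (b <= ht t)%O -> club_in (below b) (cs t b) &
      forall b c, (b <= ht t)%O -> cs t b c -> limit_point (cs t b) c ->
        cs t c = cs t b `&` below c].

Definition ext t s : Prop :=
  (ht t <= ht s)%O /\ forall b, (b <= ht t)%O -> cs s b = cs t b.

Definition restr t a : node K :=
  Node a (fun b => if (b <= a)%O then cs t b else set0).

Lemma ext_refl t : ext t t. Proof. by []. Qed.

Lemma ext_trans t s u : ext t s -> ext s u -> ext t u.
Proof.
move=> [ts tsE] [su suE]; split=> [|b bt]; first exact: le_trans su.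
by rewrite suE ?tsE// (le_trans bt).
Qed.

Lemma ext_anti t s : coherent t -> coherent s -> ext t s -> ext s t -> t = s.
Proof.
case: t s => [a C] [b D] [/= C0 _ _] [/= D0 _ _] [/= ab CD] [/= ba _].
have {ab ba} ab : a = b by apply: le_anti; rewrite ab.
move: CD; rewrite -ab => CD; congr Node; apply: funext => c.
have [/CD//|ac] := leP c a; by rewrite C0 ?D0 -?ab.
Qed.

Lemma ext_eq t s : coherent t -> coherent s -> ext t s -> ht t = ht s -> t = s.
Proof.
move=> ct cs ts E; apply: ext_anti => //; split; first by rewrite E.
by move=> b; rewrite -E => bt; rewrite ts.2.
Qed.

Lemma ext_comparable t s u : ext t u -> ext s u -> (ht t <= ht s)%O -> ext t s.
Proof. by move=> [_ tu] [_ su] ts; split=> // b bt;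
  rewrite -su ?tu// (le_trans bt). Qed.

Lemma restr_ext t a : (a <= ht t)%O -> ext (restr t a) t.
Proof. by move=> at_; split=> // b /= ->. Qed.

Lemma restr_coherent t a : (a <= ht t)%O -> coherent t -> coherent (restr t a).
Proof.
move=> at_ [_ t_club t_coh]; split=> /= [b|b ba|b c ba].
- by rewrite ltNge => /negbTE ->.
- by rewrite ba; apply: t_club; exact: le_trans at_.
- rewrite ba => tbc /t_coh; have tb := le_trans ba at_.
  have [[tb_sub _] _] := t_club _ tb.
  by rewrite (le_trans (ltW (tb_sub _ tbc)) ba) => ->.
Qed.

Lemma ext_restr t s : coherent t -> coherent s -> ext t s -> restr s (ht t) = t.
Proof.
move=> ct cs ts; apply/esym/ext_eq => //; first exact: restr_coherent ts.1 cs.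
by apply: (ext_comparable ts) => //; exact: restr_ext ts.1.
Qed.

Lemma restr_restr t a b : (b <= a)%O -> restr (restr t a) b = restr t b.
Proof.
move=> ba; congr Node; apply: funext => c /=; case: ifP => // cb.
by rewrite (le_trans cb).
Qed.

Lemma cofinal_below_inj a b C :
  cofinal_in (below a) C -> cofinal_in (below b) C -> a = b.
Proof.
have le_of a' b' : cofinal_in (below a') C -> cofinal_in (below b') C -> (b' <= a')%O.
  move=> [Ca _] [_ C_cof]; rewrite leNgt; apply/negP => /C_cof[c /Ca ca].
  by rewrite leNgt ca.
by move=> Ca Cb; apply: le_anti; rewrite !le_of.
Qed.

Hypothesis K_inaccessible : strongly_inaccessible K.

(* A cofinal subset of [below b] determines b, so a node is determined by the
   set of its values. *)
Lemma small_coherent a : small K (coherent `&` [set t | (ht t <= a)%O]).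
Proof.
pose F t : set (set K) := [set cs t b | b in [set b | (b <= ht t)%O]].
have FS := small_powerset K_inaccessible
  (small_powerset K_inaccessible (small_below a)).
apply: (small_inj (f := F)) FS => [t [[_ t_club _] ta] _ [b bt <-] c|].
  by move=> /((t_club b bt).1.1)/lt_le_trans; apply; exact: le_trans ta.
have F_ext t s : coherent t -> coherent s -> F t `<=` F s -> ext t s.
  move=> [_ t_club _] [_ s_club _] ts.
  have E b : (b <= ht t)%O -> (b <= ht s)%O /\ cs s b = cs t b.
    move=> bt; have [c cs_ E] := ts (cs t b) (ex_intro2 _ _ b bt erefl).
    suff bc : b = c by rewrite -bc in cs_ E.
    by apply: cofinal_below_inj (t_club b bt).1 _; rewrite -E; have [] := s_club c cs_.
  split=> [|b /E[]//]; by have [] := E _ (lexx _).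
move=> t s /set_mem[ct _] /set_mem[cs _] /seteqP[ts st].
by apply: ext_anti => //; exact: F_ext.
Qed.

(** Each height carries fewer than kappa coherent nodes, so all of them can be coded by ordinals
    below kappa. Through such a code the diamond sequence guesses sets of nodes. *)
Lemma node_code : exists f : node K -> K, set_inj coherent f.
Proof.
apply: (small_fibers_inj K_inaccessible (r := @ht _ K)) => a.
apply: (small_inj (f := id)) (small_coherent a) => [t [ct /= ->]//|].
by move=> ? ? _ _.
Qed.

End Nodes.

(** * Recursive definition of the tree and gluing of branches *)

Section Tree.
Context (d : Order.disp_t) (K : orderType d).
Hypothesis wfK : well_founded (fun a b : K => (a < b)%O).
Context (S : set K) (G : K -> set (node K)).
Implicit Types (a b c : K) (C D : set K) (s t u z w : node K) (M : set (node K)).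

(** Only extensions of height below a are consulted, so the notion depends on the tree below level a
    alone and may enter its recursive definition. *)
Definition decides (T : set (node K)) a z : Prop :=
  G a z \/ forall s, T s -> (ht s < a)%O -> ext z s -> ~ G a s.

(* A node whose height reaches b in S has met the set G b guessed at b, or has
   left it for good, already below b. *)
Let tree_step a (T : forall b, (b < a)%O -> set (node K)) : set (node K) := fun t =>
  coherent t /\ forall b, (b <= a)%O -> S b -> below b !=set0 ->
    exists2 c, (c < b)%O &
      decides (fun s => exists sa : (ht s < a)%O, T (ht s) sa s) b (restr t c).

Definition tree : set (node K) := fun t =>
  Fix wfK (fun=> set (node K)) tree_step (ht t) t.

Lemma treeP t : tree t <->
  coherent t /\ forall b, (b <= ht t)%O -> S b -> below b !=set0 ->
    exists2 c, (c < b)%O & decides tree b (restr t c).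
Proof.
rewrite {1}/tree Fix_eq; last first.
  move=> a T T' TT'; congr tree_step.
  by do 2!apply: functional_extensionality_dep => ?.
rewrite {1}/tree_step; split=> -[ct tP]; split=> // b bt Sb b0.
  have [c cb [Gc|nG]] := tP b bt Sb b0; exists c => //; [by left|right].
  by move=> s Ts sb; apply: nG => //; exists (lt_le_trans sb bt).
have [c cb [Gc|nG]] := tP b bt Sb b0; exists c => //; [by left|right].
by move=> s [_ Ts]; exact: nG.
Qed.

Lemma tree_coherent t : tree t -> coherent t.
Proof. by move=> /treeP[]. Qed.

Lemma tree_restr t a : (a <= ht t)%O -> tree t -> tree (restr t a).
Proof.
move=> at_ /treeP[ct tP]; apply/treeP; split; first exact: restr_coherent.
move=> b /= ba Sb b0; have [c cb dc] := tP b (le_trans ba at_) Sb b0.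
by exists c => //; rewrite restr_restr// (le_trans (ltW cb)).
Qed.

(** The union of the chain M, topped by the value C at a. It serves at limits, at successors with a
    single node in M, and at zero with M empty. At a in S the deciding node y must lie below a
    member of M, since it has to be a restriction of w. *)
Lemma tree_glue M a C :
  M `<=` tree -> (forall t s, M t -> M s -> ext t s \/ ext s t) ->
  (forall t, M t -> (ht t < a)%O) ->
  (forall b, (b < a)%O -> exists2 t, M t & (b <= ht t)%O) ->
  club_in (below a) C ->
  (forall t b, M t -> C b -> limit_point C b -> (b <= ht t)%O ->
    cs t b = C `&` below b) ->
  (S a -> below a !=set0 ->
    exists y t, [/\ coherent y, ext y t, M t & decides tree a y]) ->
  exists w, [/\ tree w, ht w = a, cs w a = C & forall t, M t -> ext t w].
Proof.
move=> MT M_chain M_lt M_cof C_club C_coh C_dec.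
(* Below a, the value at b is read off from any member of M that reaches b; they all agree because M
   is a chain. *)
pose w := Node a (fun b => if b == a then C else
  [set x | exists t, [/\ M t, (b <= ht t)%O & cs t b x]]).
have wM t : M t -> ext t w.
  move=> Mt; split=> [|b bt /=]; first exact/ltW/M_lt.
  rewrite lt_eqF ?(le_lt_trans bt) ?M_lt//; apply/seteqP; split=> x.
    move=> [s [Ms bs]]; have [ts|st] := M_chain _ _ Mt Ms.
      by rewrite ts.2.
    by rewrite st.2.
  by exists t.
have wa : cs w a = C by rewrite /= eqxx.
have w_lt b : (b < a)%O -> exists t, [/\ M t, (b <= ht t)%O & cs w b = cs t b].
  by move=> /M_cof[t Mt bt]; exists t; rewrite (wM t Mt).2.
have w_coherent : coherent w.
  split=> [b /= ab|b|b c].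
  - rewrite gt_eqF//; apply/seteqP; split=> // x [t [/M_lt ta bt _]].
    by have := lt_le_trans ab (le_trans bt (ltW ta)); rewrite ltxx.
  - rewrite [ht w]/= le_eqVlt => /orP[/eqP ->|/w_lt[t [Mt bt ->]]].
      by rewrite wa.
    by have [_ + _] := tree_coherent (MT _ Mt); exact.
  - rewrite [ht w]/= le_eqVlt => /orP[/eqP ->|/w_lt[t [Mt bt ->]]].
      rewrite wa => Cc limc; have /w_lt[t [Mt ct ->]] := C_club.1.1 _ Cc.
      exact: C_coh.
    have [_ t_club t_coh] := tree_coherent (MT _ Mt).
    move=> tbc limc; rewrite -t_coh//; apply: (wM t Mt).2.
    exact: le_trans (ltW ((t_club b bt).1.1 _ tbc)) bt.
have restr_w t : M t -> restr w (ht t) = t.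
  by move=> Mt; apply: ext_restr (wM _ Mt) => //; exact/tree_coherent/MT.
exists w; split=> //.
apply/treeP; split=> // b;
  rewrite /= le_eqVlt => /orP[/eqP ->|] => [Sa a0|/M_cof[t Mt bt] Sb b0].
  have [y [t [cy yt Mt dy]]] := C_dec Sa a0; exists (ht y).
    by apply: le_lt_trans yt.1 _; exact: M_lt.
  by rewrite ext_restr//; exact: ext_trans yt (wM _ Mt).
have /treeP[_ /(_ b bt Sb b0)[c cb dc]] := MT _ Mt; exists c => //.
by rewrite -(restr_w t Mt) restr_restr ?(le_trans (ltW cb)) in dc.
Qed.

End Tree.

(** * Every node extends to every higher level *)

Section Extension.
Context (d : Order.disp_t) (K : orderType d).
Hypothesis wfK : well_founded (fun a b : K => (a < b)%O).
Context (S : set K) (G : K -> set (node K)).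
Hypothesis S_nonreflecting : nonreflecting S.
Implicit Types (a b c : K) (C D E : set K) (s t u z w : node K).
Local Notation T := (tree wfK S G).

(* At an ordinal of uncountable cofinality this is nonreflection; otherwise a
   cofinal sequence of type at most omega has no limit point below a. *)
Lemma ladder a : exists E, club_in (below a) E /\
  forall b, (b < a)%O -> limit_point E b -> ~ S b.
Proof.
have [/S_nonreflecting|] := pselect (uncountable_cofinality a).
  move=> /existsNP[E /not_implyP[E_club SE]]; exists E; split=> // b ba limb Sb.
  by apply: SE; exists b; do !split=> //; exact: E_club.2 b ba limb.
move=> /existsNP[C /not_implyP[C_cof /contrapT C_count]].
have [E [E_club noE]] := countable_cofinal_club C_cof C_count.
by exists E; split=> // b /noE.
Qed.

(** The club of [ladder] with everything below y removed and y added. As y becomes the least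
    element, no new limit point arises, and a climb along E can start at height y. *)
Lemma ladder_from a y : (y < a)%O -> exists E, [/\ club_in (below a) E, E y,
  forall b, E b -> (y <= b)%O & forall b, (b < a)%O -> limit_point E b -> ~ S b].
Proof.
move=> ya; have [e [e_club eS]] := ladder a.
pose E := [set b | b = y \/ e b /\ (y < b)%O].
have E_ge b : E b -> (y <= b)%O by move=> [->//|[_ /ltW]].
have E_lim b : limit_point E b -> limit_point e b /\ (y < b)%O.
  move=> /limit_pointP[b0 lim].
  have yb : (y < b)%O.
    have [b' /lim[c Ec /andP[_ cb]]] := b0.
    exact: le_lt_trans (E_ge _ Ec) cb.
  split=> //; apply/limit_pointP; split=> // b' b'b.
  have /lim[c [->|[ec _]]] : (Order.max b' y < b)%O by rewrite gt_max b'b.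
    by rewrite gt_max ltxx andbF.
  by rewrite gt_max => /andP[/andP[b'c _] cb]; exists c => //; rewrite b'c.
exists E; split=> //; last by move=> b ba /E_lim[/(eS _ ba)].
  split; last by move=> b ba /E_lim[limb yb]; right; split=> //; exact: e_club.2.
  split=> [b [->//|[/(e_club.1.1)]]//|b ba].
  have /(e_club.1.2)[c ec] : (Order.max b y < a)%O by rewrite gt_max ba.
  rewrite ge_max => /andP[bc]; rewrite le_eqVlt => /orP[/eqP yc|yc].
    by exists y; [left|rewrite yc].
  by exists c => //; right.
by left.
Qed.

(** If x has an extension below level a in the guessed set, move to it; otherwise x itself has
    already left that set. *)
Lemma decide_below a x : T x -> (ht x < a)%O ->
  exists y, [/\ ext x y, T y, (ht y < a)%O & decides G T a y].
Proof.
move=> Tx xa; have [[s [Ts sa xs Gs]]|nex] :=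
  pselect (exists s, [/\ T s, (ht s < a)%O, ext x s & G a s]).
  by exists s; split=> //; left.
by exists x; split=> //; right => s Ts sa xs Gs; apply: nex; exists s.
Qed.

(** Induction on a. If there were no w, a maximal climb along E would stop below a, and the
    induction hypothesis would lift it to the next point of E. *)
Lemma extend a x : T x -> (ht x < a)%O -> exists w, [/\ T w, ht w = a & ext x w].
Proof.
elim/(well_founded_ind wfK): a x => a IH x Tx xa.
have [y [xy Ty ya dy]] := decide_below Tx xa.
have [E [E_club Ey E_ge E_S]] := ladder_from ya.
apply: contrapT => nw.
have T_coh t : T t -> coherent t by exact: tree_coherent.
(* Climbing along E: as E has no limit point in S, the climb never meets a guess
   at a limit stage, and E itself is the thread to be used there. Zorn's lemma
   replaces the recursion. *)
pose good z := [/\ T z, ext y z, E (ht z), (ht z < a)%O & forall b,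
  (b <= ht z)%O -> E b -> limit_point E b -> cs z b = E `&` below b].
have E_lim0 b : (b <= ht y)%O -> ~ limit_point E b.
  move=> b_y /limit_pointP[[b' b'b] /(_ _ b'b)[c /E_ge yc /andP[_ cb]]].
  by have := le_lt_trans yc (lt_le_trans cb b_y); rewrite ltxx.
have good_y : good y by split=> // b /E_lim0.
have E_cap b : (b < a)%O -> limit_point E b ->
    club_in (below b) (E `&` below b) /\
    forall c, (c < b)%O -> limit_point (E `&` below b) c -> limit_point E c.
  move=> ba limb; have lim_cap c : limit_point (E `&` below b) c -> limit_point E c.
    move=> /limit_pointP[c0 lim]; apply/limit_pointP; split=> // b' /lim[b'' []].
    by move=> Eb'' _ ?; exists b''.
  split=> [|c _]; last exact: lim_cap.
  split; first split=> [c []//|c cb].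
    have /limit_pointP[_ /(_ _ cb)[c' Ec' /andP[/ltW cc' c'b]]] := limb.
    by exists c'.
  move=> c cb /lim_cap limc; split=> //; apply: E_club.2 => //.
  exact: lt_trans cb ba.
pose GT := {z | good z}.
pose R (u v : GT) : bool := `[< ext (sval u) (sval v) >].
(* A chain of good nodes with heights unbounded in a can be glued with E itself as the value at a.
   Should a lie in S, its guess is decided by y. The result would be the excluded w. *)
have chain_bounded (A : set GT) : total_on A R ->
    exists2 b, (b < a)%O & forall z : GT, A z -> (ht (sval z) < b)%O.
  move=> A_chain; apply: contrapT => A_unb; apply: nw.
  have A_cof b : (b < a)%O -> exists2 z : GT, A z & (b <= ht (sval z))%O.
    move=> ba; apply: contrapT => nz; apply: A_unb; exists b => // z Az.
    by rewrite ltNge; apply/negP => bz; apply: nz; exists z.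
  have [|||||||w [Tw wa _ Mw]] := @tree_glue _ _ wfK S G (sval @` A) a E.
  - by move=> _ [[z [Tz ? ? ? ?]] _ <-].
  - move=> _ _ [t At <-] [s As <-].
    by have [/asboolP|/asboolP] := A_chain _ _ At As; [left|right].
  - by move=> _ [[z [? ? ? za ?]] _ <-].
  - by move=> b /A_cof[z Az bz]; exists (sval z) => //; exists z.
  - exact: E_club.
  - by move=> _ b [[z [? ? ? za zE]] _ <-] Eb limb /= bz; exact: zE.
  - move=> _ _; have [z Az _] := A_cof _ ya; exists y, (sval z); split=> //.
    + exact: T_coh.
    + by have [] := svalP z.
  exists w; split=> //; have [z Az _] := A_cof _ ya.
  apply: ext_trans xy _; have [_ yz _ _ _] := svalP z.
  by apply: ext_trans yz _; apply: Mw; exists z.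
have [||||[z gz] z_max] := @Zorn GT R.
- by move=> u; apply/asboolP; exact: ext_refl.
- by move=> u v w /asboolP uv /asboolP vw; apply/asboolP; exact: ext_trans uv vw.
- move=> [u gu] [v gv] /asboolP /= uv /asboolP /= vu; apply: eq_exist.
  by apply: ext_anti => //; apply: T_coh; [case: gu|case: gv].
- move=> A A_chain; have [b ba Ab] := chain_bounded A A_chain.
  (* Three cases: the empty chain is bounded by y; if the supremum c of the heights is attained, the
     node attaining it is the bound; otherwise c is a limit point of E, hence outside S, and the
     chain is glued with the part of E below c. *)
  have [[z0 Az0]|A0] := pselect (A !=set0); last first.
    by exists (exist _ y good_y) => z Az; case: A0; exists z.
  have [c c_ub c_min] : exists2 c,
      forall z : GT, A z -> (ht (sval z) <= c)%O &
      forall b, (forall z : GT, A z -> (ht (sval z) <= b)%O) -> (c <= b)%O.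
    by apply: (@ex_least _ _ wfK [set c | forall z : GT, A z -> _]);
      exists b => z /Ab/ltW.
  have A_T (z : GT) : A z -> T (sval z) by have [] := svalP z.
  have [[z1 Az1 z1c]|c_natt] := pselect (exists2 z : GT, A z & ht (sval z) = c).
    exists z1 => z Az; have [//|/asboolP z1z] := A_chain _ _ Az Az1.
    apply/asboolP; suff <- : sval z1 = sval z by exact: ext_refl.
    apply: (ext_eq _ _ z1z); [exact/T_coh/A_T|exact/T_coh/A_T|].
    by apply: le_anti; rewrite z1z.1 z1c c_ub.
  have A_lt (z : GT) : A z -> (ht (sval z) < c)%O.
    by move=> Az; rewrite lt_neqAle c_ub// andbT; apply/eqP => zc; apply: c_natt;
      exists z.
  have A_gt b' : (b' < c)%O -> exists2 z : GT, A z & (b' < ht (sval z))%O.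
    move=> b'c; apply: contrapT => nz; move: b'c; rewrite ltNge => /negP; apply.
    apply: c_min => z Az; rewrite leNgt; apply/negP => b'z; apply: nz; by exists z.
  have ca : (c < a)%O by apply: le_lt_trans ba; apply: c_min => z /Ab/ltW.
  have limc : limit_point E c.
    apply/limit_pointP; split; first by exists (ht (sval z0)); exact: A_lt.
    move=> b' /A_gt[z Az b'z]; exists (ht (sval z)); first by have [] := svalP z.
    by rewrite b'z A_lt.
  have Ec := E_club.2 c ca limc; have [Ec_club Ec_lim] := E_cap c ca limc.
  have [|||||||w [Tw wc wC Aw]] := @tree_glue _ _ wfK S G (sval @` A) c (E `&` below c).
  - by move=> _ [z Az <-]; exact: A_T.
  - move=> _ _ [t At <-] [s As <-].
    by have [/asboolP|/asboolP] := A_chain _ _ At As; [left|right].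
  - by move=> _ [z Az <-]; exact: A_lt.
  - by move=> b' /A_gt[z Az /ltW b'z]; exists (sval z) => //; exists z.
  - exact: Ec_club.
  - move=> _ b' [z Az <-] [Eb' b'c] /(Ec_lim _ b'c) limb' b'z.
    have [_ _ _ _ ->//] := svalP z; rewrite -setIA; congr (_ `&` _).
    by apply/seteqP; split=> [x' xb'|x' []//]; split=> //; exact: lt_trans xb' b'c.
  - by move=> /(E_S _ ca limc).
  have gw : good w.
    split=> //; rewrite ?wc//.
      by apply: ext_trans (Aw _ (ex_intro2 _ _ z0 Az0 erefl)); have [] := svalP z0.
    move=> b'; rewrite le_eqVlt => /orP[/eqP ->//|b'c Eb' limb'].
    have [z Az /ltW b'z] := A_gt _ b'c.
    rewrite (Aw _ (ex_intro2 _ _ z Az erefl)).2//.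
    by have [_ _ _ _] := svalP z; exact.
  by exists (exist _ w gw) => z Az; apply/asboolP; apply: Aw; exists z.
have [Tz yz Ez za z_lim] := gz.
(* c is the next point of E above [ht z]. It is no limit point of E, so a node of height c above z
   is again good, against the maximality of z. *)
have [c [Ec zc] c_min] : exists2 c, E c /\ (ht z < c)%O &
    forall b, E b /\ (ht z < b)%O -> (c <= b)%O.
  apply: (@ex_least _ _ wfK [set c | E c /\ (ht z < c)%O]).
  (* Applied to z alone, [chain_bounded] excludes that a is the successor of [ht z]. *)
  have [|b ba zb] := chain_bounded [set (exist _ z gz)].
    by move=> _ _ -> ->; left; apply/asboolP; exact: ext_refl.
  have [c Ec bc] := E_club.1.2 _ ba; exists c; split=> //.
  by apply: lt_le_trans bc; exact: (zb _ erefl).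
have ca := E_club.1.1 _ Ec.
have [w [Tw wc zw]] := IH c ca z Tz zc.
suff gw : good w.
  have /(congr1 sval) /= wz := z_max (exist _ w gw) (asboolT zw).
  by move: zc; rewrite -wc wz ltxx.
split=> //; rewrite ?wc//; first exact: ext_trans yz zw.
move=> b bc Eb limb; have [bz|zb] := leP b (ht z); first by rewrite zw.2// z_lim.
have bE : b = c by apply: le_anti; rewrite bc c_min.
move: limb => /limit_pointP[_]; rewrite bE => /(_ _ zc)[c' Ec' /andP[zc' c'c]].
by move: c'c; rewrite ltNge c_min.
Qed.

Lemma extend_le a x : T x -> (ht x <= a)%O -> exists w, [/\ T w, ht w = a & ext x w].
Proof.
by move=> Tx; rewrite le_eqVlt => /orP[/eqP xa|]; [exists x|exact: extend].
Qed.

End Extension.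

(** * Generic limits, splitting and guessed sets of nodes *)

Section TreeProperties.
Context (d : Order.disp_t) (K : orderType d).
Hypothesis K_inaccessible : strongly_inaccessible K.
Hypothesis wfK : well_founded (fun a b : K => (a < b)%O).
Context (S : set K).
Hypothesis S_nonreflecting : nonreflecting S.
Implicit Types (a b c : K) (C D E : set K) (s t u z w : node K).

(** Fewer than kappa nodes have height at most a, so F is bounded on them; taking the least bound at
    every a makes [h] monotone. *)
Lemma node_bound (F : node K -> K) : exists h : K -> K,
  [/\ forall a, (a < h a)%O,
      forall a b, (a <= b)%O -> (h a <= h b)%O &
      forall t a, coherent t -> (ht t <= a)%O -> (F t < h a)%O].
Proof.
pose B a b := (a < b)%O /\ forall t, coherent t -> (ht t <= a)%O -> (F t < b)%O.
have /choice[h hP] : forall a, exists b, B a b /\ forall b', B a b' -> (b <= b')%O.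
  move=> a; have [b [Bab b_min]] : exists2 b, B a b & forall b', B a b' -> (b <= b')%O.
    apply: (@ex_least _ _ wfK (B a)).
    have [b bF] := small_bounded K_inaccessible F (small_coherent K_inaccessible a).
    have [c [ac bc]] := ex_ub2 K_inaccessible a b.
    by exists c; split=> // t ct ta; apply: lt_trans bc; exact: bF.
  by exists b.
exists h; split=> [a|a b ab|t a]; first by have [[]] := hP a.
  have [_] := hP a; apply; have [[bh bF] _] := hP b.
  by split=> [|t ct ta]; [exact: le_lt_trans ab bh|apply: bF; rewrite ?(le_trans ta)].
by have [[_ +] _] := hP a; exact.
Qed.

Section AnyGuess.
Context (G : K -> set (node K)).
Local Notation T := (tree wfK S G).

(** The combinatorial core of unthreadability. In the application [P t b] says that t forces b into
    a given club; r makes this club unbounded below [ht r] while its own value there omits a member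
    b. *)
Lemma generic_limit y (P : node K -> K -> Prop) : T y ->
  (forall t, T t -> ext y t -> exists s b, [/\ T s, ext t s, (ht t < b)%O & P s b]) ->
  (forall t s b, T t -> T s -> ext t s -> P t b -> P s b) ->
  exists r, [/\ T r, ext y r,
    forall c, (c < ht r)%O -> exists2 b, (c < b < ht r)%O & P r b &
    exists b, [/\ (b < ht r)%O, P r b & ~ cs r (ht r) b]].
Proof.
move=> Ty P_unb P_up.
have /choice[f fP] : forall t, exists sb : node K * K, T t -> ext y t ->
    [/\ T sb.1, ext t sb.1, (ht t < sb.2)%O & P sb.1 sb.2].
  move=> t; have [[Tt yt]|nt] := pselect (T t /\ ext y t).
    by have [s [b sbP]] := P_unb t Tt yt; exists (s, b).
  by exists (t, ht t) => Tt yt; case: nt.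
have [h [h_gt h_homo hF]] := node_bound (fun t => Order.max (ht (f t).1) (f t).2).
have [u [a [u0 u_h u_homo u_cof /(_ h_homo) a_closed]]] :=
  closure_point_sup K_inaccessible h_gt (ht y).
have u_lt n : (u n < a)%O by apply: u_cof.1; exists n.
have ya : (ht y < a)%O by rewrite -u0.
(* As a may lie in S, its guess is settled first and the climb starts from y1. *)
have [y1 [yy1 Ty1 y1a dy1]] := decide_below Ty ya.
(* From index k on, the sequence is at or above [ht y1]. The node of stage n has height at most
   [u (k + n)]; the next one reaches this height and satisfies P at some ordinal strictly between it
   and a. *)
have [_ [k _ <-] y1k] := u_cof.2 _ y1a.
pose I n t := [/\ T t, ext y1 t & (ht t <= u (k + n))%O].
pose step n t t' := [/\ I n.+1 t', ext t t', (u (k + n) <= ht t')%O &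
  exists b, (u (k + n) < b < a)%O /\ P t' b].
have /choice[g gP] : forall nt : nat * node K, exists t', I nt.1 nt.2 ->
  step nt.1 nt.2 t'.
  move=> [n t] /=; have [[Tt yt tu]|nI] := pselect (I n t); last by exists t.
  have [t1 [Tt1 t1u tt1]] := extend_le S_nonreflecting Tt tu.
  have yt1 := ext_trans yt tt1.
  have [Tf t1f t1b Pf] := fP t1 Tt1 (ext_trans yy1 yt1).
  have := hF t1 (u (k + n)) (tree_coherent Tt1);
    rewrite t1u lexx gt_max => /(_ isT)/andP[fh bh].
  exists (f t1).1 => _; split.
  - by split=> //; [exact: ext_trans yt1 t1f|rewrite addnS;
    exact: le_trans (ltW fh) (u_h _)].
  - exact: ext_trans tt1 t1f.
  - by rewrite -t1u; exact: t1f.1.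
  - exists (f t1).2; split=> //; rewrite -{1}t1u t1b.
    exact: lt_trans (lt_le_trans bh (u_h _)) (u_lt _).
pose q := fix q n := if n is m.+1 then g (m, q m) else y1.
have qI n : I n (q n).
  by elim: n => [|n IHn]; [split=> //; rewrite addn0|have [] := gP (n, q n) IHn].
have qP n : step n (q n) (q n.+1) := gP (n, q n) (qI n).
have q_homo m n : (m <= n)%N -> ext (q m) (q n).
  elim: n => [|n IHn]; first by rewrite leqn0 => /eqP ->.
  by rewrite leq_eqVlt => /orP[/eqP -> //|/IHn mn]; have [_ + _ _] := qP n;
    exact: ext_trans.
have [_ _ _ [b0 [/andP[_ b0a] Pb0]]] := qP 0.
have [_ [m _ <-] b0m] := u_cof.2 _ b0a.
(* At a of cofinality omega any cofinal sequence of type omega is a legal value,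
   so we may take one lying above b0. *)
pose v n := u (m.+1 + n).
have v_homo : {homo v : i j / (i <= j)%N >-> (i <= j)%O}.
  by move=> i j ij; apply: u_homo; rewrite leq_add2l.
have v_cof : cofinal_in (below a) (range v).
  split=> [_ [n _ <-]|b /u_cof.2[_ [n _ <-] bn]]; first exact: u_lt.
  by exists (v n); [exists n|apply: (le_trans bn); apply: u_homo; rewrite leq_addl].
have b0v n : (b0 < v n)%O.
  apply: (le_lt_trans b0m); apply: (lt_le_trans (h_gt _)); apply: (le_trans (u_h m)).
  by apply: u_homo; rewrite leq_addr.
have [|||||||r [Tr ra rC qr]] := @tree_glue _ _ wfK S G (range q) a (range v).
- by move=> _ [n _ <-]; have [] := qI n.
- move=> _ _ [i _ <-] [j _ <-]; have [ij|/ltnW ji] := leqP i j.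
    by left; exact: q_homo.
  by right; exact: q_homo.
- by move=> _ [n _ <-]; have [_ _ /le_lt_trans] := qI n; apply.
- move=> b /u_cof.2[_ [n _ <-] bn]; exists (q n.+1); first by exists n.+1.
  have [_ _ qn _] := qP n; apply: le_trans bn (le_trans _ qn).
  by apply: u_homo; rewrite leq_addl.
- exact: range_club.
- by move=> t b _ /v_cof.1 ba /(range_no_limit v_homo v_cof ba).
- move=> _ _; exists y1, y1; split=> //; first exact: tree_coherent Ty1.
  by exists 0.
have q_r n : ext (q n) r by apply: qr; exists n.
have qT n : T (q n) by have [] := qI n.
exists r; split=> //.
- exact: ext_trans yy1 (q_r 0).
- rewrite ra => c /u_cof.2[_ [n _ <-] cn]; have [_ _ _ [b [/andP[nb ba] Pb]]] := qP n.
  exists b; last exact: (P_up _ _ _ (qT n.+1) Tr (q_r n.+1) Pb).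
  rewrite ba andbT; apply: le_lt_trans nb; apply: (le_trans cn).
  by apply: u_homo; rewrite leq_addl.
- exists b0; rewrite ra rC; split=> //; first exact: (P_up _ _ _ (qT 1) Tr (q_r 1) Pb0).
  by move=> [n _ vb0]; have := b0v n; rewrite vb0 ltxx.
Qed.

(** At the successor a2 of a1, a value only has to contain the predecessor a1. Hence the set of a1
    alone and the set of [ht t] and a1 are both legal, and they differ because [ht t] < a1. *)
Lemma tree_split t : T t -> exists s1 s2,
  [/\ T s1, T s2, ext t s1, ext t s2 & ~ ext s1 s2 /\ ~ ext s2 s1].
Proof.
move=> Tt.
have ex_succ a : exists2 b, (a < b)%O & forall c, (a < c)%O -> (b <= c)%O.
  exact: (ex_least wfK (ex_gt K_inaccessible a)).
have [a1 ta1 _] := ex_succ (ht t); have [a2 a12 a2_min] := ex_succ a1.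
have le_a1 b : (b < a2)%O -> (b <= a1)%O.
  by move=> ba2; rewrite leNgt; apply/negP => /a2_min; rewrite leNgt ba2.
have [y [ty Ty ya2 dy]] := decide_below Tt (lt_trans ta1 a12).
have [t1 [Tt1 t1a1 yt1]] := extend_le S_nonreflecting Ty (le_a1 _ ya2).
(* The values are presented as ranges of eventually constant sequences, so that [range_club] applies
   to them. *)
have branch (v : nat -> K) : {homo v : i j / (i <= j)%N >-> (i <= j)%O} ->
    (forall n, v n < a2)%O -> v 1 = a1 ->
    exists s, [/\ T s, ht s = a2, cs s a2 = range v & ext t s].
  move=> v_homo v_lt v1.
  have v_cof : cofinal_in (below a2) (range v).
    split=> [_ [n _ <-]|b /le_a1 ba1]; first exact: v_lt.
    by exists a1 => //; exists 1.
  have [|||||||s [Ts sa2 sC t1s]] := @tree_glue _ _ wfK S G [set t1] a2 (range v).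
  - by move=> _ ->.
  - by move=> _ _ -> ->; left.
  - by move=> _ ->; rewrite t1a1.
  - by move=> b /le_a1 ba1; exists t1 => //; rewrite t1a1.
  - exact: range_club.
  - by move=> t' b _ /v_cof.1 ba /(range_no_limit v_homo v_cof ba).
  - by move=> _ _; exists y, t1; split=> //; exact: tree_coherent Ty.
  by exists s; split=> //; apply: ext_trans ty (ext_trans yt1 _); exact: t1s.
have [//|//|//|s1 [Ts1 s1a s1C ts1]] := branch (fun=> a1).
have [| |//|s2 [Ts2 s2a s2C ts2]] := branch (fun n => if n is 0 then ht t else a1).
- by move=> [|i] [|j] //= _; exact: ltW.
- by move=> [|n] //; exact: lt_trans ta1 a12.
suff C12 : cs s1 a2 <> cs s2 a2.
  exists s1, s2; split=> //; split=> [[_ E]|[_ E]]; apply: C12; first by rewrite E ?s1a.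
  by rewrite E ?s2a.
rewrite s1C s2C => /seteqP[_ /(_ (ht t))[|n _ ta]]; first by exists 0.
by move: ta1; rewrite -ta ltxx.
Qed.

End AnyGuess.

(** The function [h] bounds the code of each node and the height of a chosen extension in U, if
    there is one. At a closure point a where U is guessed correctly, the guess therefore speaks of
    all nodes of U below level a, and a node below level a with an extension in U has one below
    level a. *)
Lemma decision (A : K -> set K) (code : node K -> K) (U : set (node K)) :
  set_inj (@coherent _ K) code ->
  stationary_in setT [set a | S a /\ (code @` U) `&` below a = A a] ->
  let T := tree wfK S (fun a t => A a (code t)) in
  U `<=` T ->
  exists a, forall t, T t -> (a <= ht t)%O -> exists s,
    [/\ ext s t, T s, (ht s < a)%O & U s \/ forall s', T s' -> ext s s' -> ~ U s'].
Proof.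
move=> code_inj A_guess T UT.
have T_coh t : T t -> coherent t by exact: tree_coherent.
have code_injT t s : T t -> T s -> code t = code s -> t = s.
  by move=> /T_coh ct /T_coh cs; apply: code_inj; exact/mem_set.
have /choice[g gP] : forall t, exists s, (exists s', U s' /\ ext t s') ->
  U s /\ ext t s.
  by move=> t; have [[s sP]|ns] := pselect (exists s', U s' /\ ext t s');
    [exists s|exists t].
have [h [h_gt h_homo hF]] := node_bound (fun t => Order.max (code t) (ht (g t))).
have [a [[Sa Aa] [a0 ha]]] := A_guess _ (closure_point_club K_inaccessible h_gt h_homo).
have F_lt t : T t -> (ht t < a)%O -> (code t < a)%O /\ (ht (g t) < a)%O.
  move=> Tt ta; apply/andP; rewrite -gt_max; apply: lt_trans (ha _ ta).
  by apply: hF => //; exact: T_coh.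
exists a => t Tt at_.
have [_ /(_ a at_ Sa a0)[c ca dc]] := (treeP _ _ _ _).1 Tt.
have ct := le_trans (ltW ca) at_.
have Ts := tree_restr ct Tt; exists (restr t c); split=> //; first exact: restr_ext.
case: dc => [Gs|nG]; [left|right].
  have : A a (code (restr t c)) by [].
  by rewrite -Aa => -[[s Us /(code_injT _ _ (UT _ Us) Ts) <-] _].
(* An extension in U of any height yields the chosen one below level a, which the negative decision
   forbids. *)
move=> s' Ts' ss' Us'; have [|Ug sg] := gP (restr t c); first by exists s'.
have [_ ga] := F_lt _ Ts ca; have Tg := UT _ Ug.
apply: (nG _ Tg ga sg); suff: A a (code (g (restr t c))) by [].
rewrite -Aa; split; first by exists (g (restr t c)).
by have [] := F_lt _ Tg ga.
Qed.

End TreeProperties.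

(** * The forcing relation *)

Section Forcing.
Context (d' : Order.disp_t) (T : porderType d').
Implicit Types (p q r : T) (x y z u v w : name T).
Local Open Scope forcing_scope.

Definition monotone (phi : fstatement T) : Prop :=
  forall p q, (p <= q)%O -> phi p -> phi q.

(** These are the regular open sets of conditions. For a stable goal, witnesses and case
    distinctions that are available only densely above p may be used as if p provided them; this is
    [stable_elim]. *)
Definition stable (phi : fstatement T) : Prop :=
  monotone phi /\ forall p, dense_above p phi -> phi p.

Lemma stable_mono phi : stable phi -> monotone phi. Proof. by case. Qed.

Lemma dense_above_mono (U : T -> Prop) p q :
  (p <= q)%O -> dense_above p U -> dense_above q U.
Proof. by move=> pq U_dense r qr; apply: U_dense; exact: le_trans qr. Qed.

Lemma dense_above_stable (U : T -> Prop) : stable (fun p => dense_above p U).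
Proof.
split=> [p q|p U_dense q /U_dense[r qr /(_ r (lexx r))[s rs Us]]].
  exact: dense_above_mono.
by exists s => //; exact: le_trans rs.
Qed.

Lemma stable_elim (phi : fstatement T) (U : T -> Prop) p : stable phi ->
  dense_above p U -> (forall r, (p <= r)%O -> U r -> phi r) -> phi p.
Proof.
move=> [_ phi_dense] U_dense Uphi; apply: phi_dense => q pq.
have [r qr Ur] := U_dense q pq; exists r => //; apply: Uphi => //.
exact: le_trans qr.
Qed.

Lemma stable_and phi psi : stable phi -> stable psi -> stable (phi ∧ psi).
Proof.
move=> [phi_mono phi_dense] [psi_mono psi_dense]; split=> [p q pq [? ?]|p pp].
  by split; [exact: phi_mono pq _|exact: psi_mono pq _].
by split; [apply: phi_dense|apply: psi_dense] => q /pp[r qr []]; exists r.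
Qed.

Lemma stable_imp phi psi : monotone phi -> stable psi -> stable (phi ⇒ psi).
Proof.
move=> phi_mono [psi_mono psi_dense]; split=> [p q pq pp r qr|p pp q pq phiq].
  by apply: pp; exact: le_trans qr.
apply: psi_dense => r qr; have [s rs ss] := pp r (le_trans pq qr).
by exists s => //; apply: ss => //; apply: phi_mono phiq; exact: le_trans rs.
Qed.

Lemma stable_all (phi : name T -> fstatement T) :
  (forall x, stable (phi x)) -> stable (f_all phi).
Proof.
move=> phi_stable; split=> [p q pq pp x|p pp x].
  by have [mono _] := phi_stable x; exact: mono pq (pp x).
by have [_ dense] := phi_stable x; apply: dense => q /pp[r qr]; exists r.
Qed.

Lemma stable_mem x y : stable (x ∈ y).
Proof. by case: y => I v b; exact: dense_above_stable. Qed.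

Lemma stable_eq x y : stable (x ≡ y).
Proof.
case: x y => I u a [J v b]; split=> [p q pq [xy yx]|p eq_dense].
  by split=> [i|j] r qr; [apply: xy|apply: yx]; exact: le_trans qr.
split=> [i|j] q pq iq q' qq'.
  have [r q'r [xy _]] := eq_dense q' (le_trans pq qq').
  have [s rs ss] := xy i r (lexx r) (le_trans iq (le_trans qq' q'r)) r (lexx r).
  by exists s => //; exact: le_trans rs.
have [r q'r [_ yx]] := eq_dense q' (le_trans pq qq').
have [s rs ss] := yx j r (lexx r) (le_trans iq (le_trans qq' q'r)) r (lexx r).
by exists s => //; exact: le_trans rs.
Qed.

Lemma stable_ex (phi : name T -> fstatement T) : stable (f_ex phi).
Proof. exact: dense_above_stable. Qed.

Lemma stable_iff phi psi : stable phi -> stable psi -> stable (phi ⇔ psi).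
Proof. by move=> ss [? ?]; apply: stable_and; apply: stable_imp => //; case: ss. Qed.

Lemma mono_eq x y : monotone (x ≡ y). Proof. by have [] := stable_eq x y. Qed.
Lemma mono_mem x y : monotone (x ∈ y). Proof. by have [] := stable_mem x y. Qed.

Lemma f_eq_refl x p : (x ≡ x) p.
Proof.
elim: x p => I u IH a p; split=> i q pq iq r qr; exists r => //; exists i.
  by split=> //; exact: le_trans qr.
by split=> //; exact: le_trans qr.
Qed.

Lemma f_eq_sym x y p : (x ≡ y) p -> (y ≡ x) p.
Proof.
elim: x y p => I u IH a [J v b] p [xy yx].
split=> [j|i] q pq jq r qr.
  by have [s rs [i [si uv]]] := yx j q pq jq r qr; exists s => //; exists i;
    split=> //; exact: IH.
by have [s rs [j [sj uv]]] := xy i q pq jq r qr; exists s => //; exists j;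
  split=> //; exact: IH.
Qed.

Lemma f_eq_trans y x z p : (x ≡ y) p -> (y ≡ z) p -> (x ≡ z) p.
Proof.
elim: x y z p => I u IH a [J v b] [L w c] p [xy yx] [yz zy].
split=> [i|l] q pq iq q' qq'.
  have [r q'r [j [jr uv]]] := xy i q pq iq q' qq'.
  have [s rs [l [ls vw]]] := yz j r (le_trans pq (le_trans qq' q'r)) jr r (lexx r).
  exists s; first exact: le_trans rs.
  by exists l; split=> //; apply: IH vw; exact: mono_eq uv.
have [r q'r [j [jr vw]]] := zy l q pq iq q' qq'.
have [s rs [i [si uv]]] := yx j r (le_trans pq (le_trans qq' q'r)) jr r (lexx r).
exists s; first exact: le_trans rs.
by exists i; split=> //; apply: IH uv _; exact: mono_eq vw.
Qed.

Lemma mem_congl x x' y p : (x ≡ x') p -> (x ∈ y) p -> (x' ∈ y) p.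
Proof.
case: y => J v b xx' xy q pq; have [r qr [j [jr xv]]] := xy q pq.
exists r => //; exists j; split=> //; apply: f_eq_trans xv; apply/f_eq_sym.
by apply: mono_eq xx'; exact: le_trans qr.
Qed.

Lemma mem_congr y y' x p : (y ≡ y') p -> (x ∈ y) p -> (x ∈ y') p.
Proof.
case: y y' => J v b [L w c] yy' xy; apply: (stable_elim (stable_mem _ _) xy).
move=> r pr [j [jr xv]] q rq; have [vw_ _] := yy'.
have [s qs [l [ls vw]]] := vw_ j r pr jr q rq.
exists s => //; exists l; split=> //; apply: f_eq_trans vw.
by apply: mono_eq xv; exact: le_trans qs.
Qed.

Lemma f_eq_ext x y p :
  (forall z q, (p <= q)%O -> (z ∈ x) q -> (z ∈ y) q) ->
  (forall z q, (p <= q)%O -> (z ∈ y) q -> (z ∈ x) q) -> (x ≡ y) p.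
Proof.
case: x y => I u a [J v b] xy yx; split=> [i|j] q pq iq.
  apply: xy => // r qr; exists r => //; exists i; split; last exact: f_eq_refl.
  exact: le_trans qr.
have vu : (v j ∈ Name u a) q.
  apply: yx => // r qr; exists r => //; exists j; split; last exact: f_eq_refl.
  exact: le_trans qr.
by move=> r /vu[s rs [i [si /f_eq_sym]]]; exists s => //; exists i.
Qed.

Definition upair x y : name T := Name (fun bp : bool * T => if bp.1 then x else y) snd.

Definition kpair x y : name T := upair (upair x x) (upair x y).

Lemma mem_upair z x y p : (z ∈ upair x y) p <-> (z ≡ x ∨ z ≡ y) p.
Proof.
split=> zxy q /zxy[r qr].
  by case=> -[[] s] [_ /= zr]; exists r => //; [left|right].
by case=> zr; exists r => //; [exists (true, r)|exists (false, r)].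
Qed.

Lemma upair_meml x y p : (x ∈ upair x y) p.
Proof. by apply/mem_upair => q _; exists q => //; left; exact: f_eq_refl. Qed.

Lemma upair_memr x y p : (y ∈ upair x y) p.
Proof. by apply/mem_upair => q _; exists q => //; right; exact: f_eq_refl. Qed.

Lemma f_upairE z x y p : f_upair z x y p <-> (z ≡ upair x y) p.
Proof.
split=> [zxy|zxy w].
  apply: f_eq_ext => w q pq; rewrite mem_upair.
    exact: (zxy w).1.
  exact: (zxy w).2.
split=> q pq; rewrite -mem_upair; apply: mem_congr; first exact: mono_eq zxy.
by apply/f_eq_sym; exact: mono_eq zxy.
Qed.

Lemma upair_congr x x' y y' p :
  (x ≡ x') p -> (y ≡ y') p -> (upair x y ≡ upair x' y') p.
Proof.
have sub u u' v v' q : (u ≡ u') q -> (v ≡ v') q ->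
    forall z, (z ∈ upair u v) q -> (z ∈ upair u' v') q.
  move=> uu' vv' z; rewrite !mem_upair => zuv r /[dup] qr /zuv[s rs zs].
  have qs := le_trans qr rs; exists s => //; case: zs => zs; [left|right].
    by apply: f_eq_trans zs _; exact: mono_eq uu'.
  by apply: f_eq_trans zs _; exact: mono_eq vv'.
move=> xx' yy'; apply: f_eq_ext => z q pq; apply: sub.
- exact: mono_eq xx'.
- exact: mono_eq yy'.
- by apply/f_eq_sym; exact: mono_eq xx'.
- by apply/f_eq_sym; exact: mono_eq yy'.
Qed.

(** Replaces the formula defining pairs by equality with a canonical name, so that statements about
    [f_app] become equalities of names. *)
Lemma f_pairE u x y p : f_pair u x y p <-> (u ≡ kpair x y) p.
Proof.
have memE z q : (f_upair z x x ∨ f_upair z x y) q <-> (z ∈ kpair x y) q.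
  rewrite mem_upair; split=> zxy r /zxy[s rs zs]; exists s => //.
    by case: zs => /f_upairE; [left|right].
  by case: zs => zs; [left|right]; apply/f_upairE.
split=> [uxy|uxy z].
  by apply: f_eq_ext => z q pq zq; [apply/memE;
    apply: (uxy z).1|apply: (uxy z).2 => //; apply/memE].
split=> q pq zq.
  by apply/memE; apply: mem_congr zq; exact: mono_eq uxy.
by move/memE: zq; apply: mem_congr; apply/f_eq_sym; exact: mono_eq uxy.
Qed.

Lemma mem_upair_elim z x y p (phi : fstatement T) : stable phi ->
  (z ∈ upair x y) p ->
  (forall q, (p <= q)%O -> (z ≡ x) q \/ (z ≡ y) q -> phi q) -> phi p.
Proof. by move=> phi_stable /mem_upair; exact: stable_elim. Qed.

Lemma upair_single x y z p : (upair y z ≡ upair x x) p -> (y ≡ x) p /\ (z ≡ x) p.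
Proof.
have single w q : (w ∈ upair x x) q -> (w ≡ x) q.
  by move=> wx; apply: (mem_upair_elim (stable_eq _ _) wx) => r _ [].
move=> yz; split; apply: single; apply: mem_congr yz _.
  exact: upair_meml.
exact: upair_memr.
Qed.

Lemma upair_cancel x y y' p : (upair x y ≡ upair x y') p -> (y ≡ y') p.
Proof.
move=> E; have yE := mem_congr E (@upair_memr x y p).
apply: (mem_upair_elim (stable_eq _ _) yE) => q pq [yx|//].
have y'E := mem_congr (f_eq_sym (mono_eq pq E)) (@upair_memr x y' q).
apply: (mem_upair_elim (stable_eq _ _) y'E) => r qr [y'x|]; last exact: f_eq_sym.
exact: f_eq_trans (mono_eq qr yx) (f_eq_sym y'x).
Qed.

(** The classical argument for Kuratowski pairs: each case distinction is decided densely above p,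
    and the conclusions are stable. *)
Lemma kpair_inj x x' y y' p : (kpair x y ≡ kpair x' y') p -> (x ≡ x') p /\ (y ≡ y') p.
Proof.
move=> E; have xx' : (x ≡ x') p.
  have xE := mem_congr E (@upair_meml (upair x x) (upair x y) p).
  apply: (mem_upair_elim (stable_eq _ _) xE) => q pq [/upair_single[]//|].
  by move=> /f_eq_sym/upair_single[/f_eq_sym].
split=> //; have {}E : (kpair x y ≡ kpair x y') p.
  apply: f_eq_trans E _; apply/f_eq_sym.
  by apply: upair_congr; apply: upair_congr => //; exact: f_eq_refl.
have yE := mem_congr E (@upair_memr (upair x x) (upair x y) p).
apply: (mem_upair_elim (stable_eq _ _) yE) => q pq [/upair_single[_ yx]|];
  last exact: upair_cancel.
have y'E := mem_congr (f_eq_sym (mono_eq pq E)) (@upair_memr (upair x x) (upair x y')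
  q).
apply: (mem_upair_elim (stable_eq _ _) y'E) => r qr [/upair_single[_ y'x]|].
  exact: f_eq_trans (mono_eq qr yx) (f_eq_sym y'x).
by move=> /upair_cancel/f_eq_sym.
Qed.

End Forcing.

(** * Square in the extension *)

Section CheckNameTheory.
Context (d : Order.disp_t) (K : orderType d).
Hypothesis wfK : well_founded (fun a b : K => (a < b)%O).
Context (d' : Order.disp_t) (T : porderType d').
Implicit Types (al be ga : K) (X Y Z B : set K) (p q r : T).
Implicit Types (x y z u v w a b : name T).
Local Open Scope forcing_scope.
Local Notation kappa := (kappa_name T wfK).

Definition ord al : name T := ord_name T (wfK al).

Definition check X : name T :=
  Name (fun bp : {be : K | X be} * T => ord (sval bp.1)) snd.

(** [ord_name] takes a proof of accessibility, but any two such proofs are equal, so the elements of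
    [ord al] are again values of [ord]. *)
Lemma ordE al : ord al = check (below al).
Proof.
rewrite /ord /check; case: (wfK al) => acc /=; congr Name; apply: funext => bp.
by rewrite /ord; congr ord_name.
Qed.

Lemma mem_check X z p :
  (z ∈ check X) p <-> dense_above p (fun r => exists2 be, X be & (z ≡ ord be) r).
Proof.
split=> zX q /zX[r qr].
  by case=> -[[be Xbe] s] [_ /= zbe]; exists r => //; exists be.
by case=> be Xbe zbe; exists r => //; exists (exist _ be Xbe, r).
Qed.

Lemma mem_kappa z p :
  (z ∈ kappa) p <-> dense_above p (fun r => exists be, (z ≡ ord be) r).
Proof.
split=> zX q /zX[r qr].
  by case=> -[be s] [_ /= zbe]; exists r => //; exists be.
by case=> be zbe; exists r => //; exists (be, r).
Qed.

Lemma ord_mem_check X be p : X be -> (ord be ∈ check X) p.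
Proof. by move=> Xbe; apply/mem_check => q _; exists q => //; exists be => //;
  exact: f_eq_refl. Qed.

Lemma ord_mem al be p : (be < al)%O -> (ord be ∈ ord al) p.
Proof. by rewrite (ordE al); exact: ord_mem_check. Qed.

(** If names of distinct ordinals were forced equal, the smaller one would be forced into itself,
    hence equal to a still smaller ordinal, against the induction hypothesis. *)
Lemma ord_inj al be p : (ord al ≡ ord be) p -> al = be.
Proof.
elim/(well_founded_ind wfK): al be p => al IH be p E.
have no_self ga q : (forall de r, (de < ga)%O -> (ord ga ≡ ord de) r -> ga = de) ->
    ~ (ord ga ∈ ord ga) q.
  move=> ga_inj; rewrite {2}ordE mem_check => /(_ q (lexx q))[r _ [de dega E']].
  have {}E' := ga_inj de r dega E'; by move: dega; rewrite /below /= E' ltxx.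
case: (ltgtP al be) => // [ab|ba].
  exfalso; have /no_self : (ord al ∈ ord al) p.
    exact: mem_congr (f_eq_sym E) (ord_mem _ ab).
  by apply=> de r dea /f_eq_sym /(IH _ dea).
exfalso; have : (ord be ∈ ord be) p by exact: mem_congr E (ord_mem _ ba).
by apply: no_self => de r _; exact: IH.
Qed.

Lemma ord_mem_checkP X be p : (ord be ∈ check X) p <-> X be.
Proof.
split=> [|]; last exact: ord_mem_check.
by move/mem_check => /(_ p (lexx p))[r _ [ga Xga /ord_inj ->]].
Qed.

(* [a ≡ ord al] and [x ≡ check X] say that a and x have the ground model values
   al and X. *)
Lemma mem_val X x be b p :
  (x ≡ check X) p -> (b ≡ ord be) p -> (b ∈ x) p <-> X be.
Proof.
move=> xX bbe; rewrite -(ord_mem_checkP _ _ p); split=> bx.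
  by apply: mem_congl bbe _; exact: mem_congr bx.
by apply: mem_congl (f_eq_sym bbe) _; apply: mem_congr bx; exact: f_eq_sym.
Qed.

Lemma ord_val al a p : (a ≡ ord al) p <-> (a ≡ check (below al)) p.
Proof. by rewrite ordE. Qed.

Lemma ord_ord_mem al be p : (ord be ∈ ord al) p <-> (be < al)%O.
Proof. by rewrite (ordE al) ord_mem_checkP. Qed.

Lemma elim_val X x z p (phi : fstatement T) : (x ≡ check X) p -> stable phi ->
  (z ∈ x) p -> (forall r be, (p <= r)%O -> X be -> (z ≡ ord be) r -> phi r) -> phi p.
Proof.
move=> xX phi_stable /(mem_congr xX)/mem_check zx H.
by apply: (stable_elim phi_stable zx) => r pr [be Xbe]; exact: H.
Qed.

Lemma cap_val Z X B z x b p :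
  (z ≡ check Z) p -> (x ≡ check X) p -> (b ≡ check B) p -> Z = X `&` B ->
  f_is_cap z x b p.
Proof.
move=> zZ xX bB ZE w; split=> q pq.
  have wstable : stable (w ∈ x ∧ w ∈ b) by apply: stable_and; exact: stable_mem.
  move=> wz; apply: (elim_val (mono_eq pq zZ) wstable wz) => r ga qr.
  have pr := le_trans pq qr.
  rewrite ZE => -[Xga Bga] wga; split.
    exact/(mem_val (mono_eq pr xX) wga).
  exact/(mem_val (mono_eq pr bB) wga).
move=> [wx wb]; apply: (elim_val (mono_eq pq xX) (stable_mem _ _) wx) =>
  r ga qr Xga wga.
have pr := le_trans pq qr.
apply/(mem_val (mono_eq pr zZ) wga); rewrite ZE; split=> //.
by apply/(mem_val (mono_eq pr bB) wga); exact: mono_mem wb.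
Qed.

(** For each ga < be, some condition above p decides an element of the intersection lying above ga;
    its value is an element of X strictly between ga and be. *)
Lemma f_limit_point_val X be x b p :
  (x ≡ check X) p -> (b ≡ ord be) p -> f_limit_point x b p -> limit_point X be.
Proof.
move=> xX /[dup] bbe /ord_val bB [/(_ p (lexx p))[p' pp' [z0 z0b]] /(_ p' pp')[q p'q
  [y [ycap yU]]]].
apply/limit_pointP; split.
  have /mem_check/(_ p' (lexx p')) := mem_congr (mono_eq pp' bB) z0b.
  by move=> [r _ [ga gabe _]]; exists ga.
move=> ga gabe; have pq := le_trans pp' p'q.
have : (ord ga ∈ b) q by apply/(mem_val (mono_eq pq bB) (f_eq_refl _ _)).
move=> /((yU (ord ga)).2 q (lexx q))/(_ q (lexx q))[r qr [w [wy gaw]]].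
have pr := le_trans pq qr.
have [wx wb] := (ycap w).1 r qr wy.
have /mem_check/(_ r (lexx r))[s rs [de Xde wde]] := mem_congr (mono_eq pr xX) wx.
have ps := le_trans pr rs.
exists de => //; apply/andP; split.
  by apply/(ord_ord_mem _ _ s); apply: mem_congr wde _; exact: mono_mem gaw.
by apply/(mem_val (mono_eq ps bB) wde); exact: mono_mem wb.
Qed.

Lemma f_closed_subset_val X al x a p :
  (x ≡ check X) p -> (a ≡ ord al) p -> club_in (below al) X ->
  f_closed_subset x a p.
Proof.
move=> xX /ord_val aA [[X_sub _] X_closed]; split=> [z q pq zx|b q pq ba r qr blim].
  apply: (elim_val (mono_eq pq xX) (stable_mem _ _) zx) => r be qr Xbe zbe.
  by apply/(mem_val (mono_eq (le_trans pq qr) aA) zbe); exact: X_sub.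
have pr := le_trans pq qr; have {}ba := mono_mem qr ba.
have := mem_congr (mono_eq pr aA) ba; move/mem_check => bA.
apply: (stable_elim (stable_mem _ _) bA) => s rs [be beal bbe].
have ps := le_trans pr rs.
apply/(mem_val (mono_eq ps xX) bbe); apply: X_closed => //.
apply: (f_limit_point_val (mono_eq ps xX) bbe).
by apply: stable_mono blim => //; apply: stable_and; exact: stable_ex.
Qed.

Lemma ord_sub al be z p : (be <= al)%O -> (z ∈ ord be) p -> (z ∈ ord al) p.
Proof.
move=> beal; rewrite !ordE !mem_check => zbe q /zbe[r qr [ga gabe zga]].
by exists r => //; exists ga => //; exact: lt_le_trans beal.
Qed.

Lemma f_same_sup_val X al x a p :
  (x ≡ check X) p -> (a ≡ ord al) p -> cofinal_in (below al) X ->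
  f_same_sup x a p.
Proof.
move=> xX /ord_val aA [X_sub X_cof] z; split=> q pq zU r qr;
  have [s rs [y [yx zy]]] := zU r qr;
  have ps := le_trans pq (le_trans qr rs).
  exists s => //; exists y; split=> //.
  apply: (elim_val (mono_eq ps xX) (stable_mem _ _) yx) => t be st Xbe ybe.
  by apply/(mem_val (mono_eq (le_trans ps st) aA) ybe); exact: X_sub.
have /mem_check/(_ s (lexx s))[t st [be /X_cof[de Xde bede] ybe]] :=
  mem_congr (mono_eq ps aA) yx.
exists t; first exact: le_trans st.
exists (ord de); split;
  first exact/(mem_val (mono_eq (le_trans ps st) xX) (f_eq_refl _ _)).
by apply: ord_sub bede _; apply: mem_congr ybe _; exact: mono_mem zy.
Qed.

(** * Forcing square with a poset of growing coherent C-sequences *)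

Section Square.
Context (ht : T -> K) (C : T -> K -> set K).
Hypothesis C_end_ext : forall p q al, (p <= q)%O -> (al <= ht p)%O -> C q al = C p al.
Hypothesis ht_homo : forall p q, (p <= q)%O -> (ht p <= ht q)%O.
Hypothesis ht_unbounded : forall p al, exists2 q, (p <= q)%O & (al <= ht q)%O.
Hypothesis C_club : forall p al, (al <= ht p)%O -> club_in (below al) (C p al).
Hypothesis C_coherent : forall p al be, (al <= ht p)%O -> C p al be ->
  limit_point (C p al) be -> C p be = C p al `&` below be.
Hypothesis C_generic : forall p (P : T -> K -> Prop),
  (forall q, (p <= q)%O -> exists r be, [/\ (q <= r)%O, (ht q < be)%O & P r be]) ->
  (forall q r be, (q <= r)%O -> P q be -> P r be) ->
  exists r, [/\ (p <= r)%O,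
    forall be, (be < ht r)%O -> exists2 ga, (be < ga < ht r)%O & P r ga &
    exists be, [/\ (be < ht r)%O, P r be & ~ C r (ht r) be]].

(* The union of the generic branch: p forces C_al = C p al for al <= ht p. *)
Definition generic_seq : name T :=
  Name (fun pa : {pa : T * K | (pa.2 <= ht pa.1)%O} =>
          kpair (ord (sval pa).2) (check (C (sval pa).1 (sval pa).2)))
       (fun pa => (sval pa).1).

(** The value is obtained only densely above p, since p itself may be too short to reach al. *)
Lemma f_app_val al a x p : (a ≡ ord al) p -> f_app generic_seq a x p ->
  dense_above p (fun r => (al <= ht r)%O /\ (x ≡ check (C r al)) r).
Proof.
move=> aal ax q pq; have [r qr [u [uc /f_pairE uax]]] := ax q pq.
have [s rs [[[t be] /= bet] [/= ts ube]]] := uc r (lexx r).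
have qs := le_trans qr rs.
have [abe xbe] := kpair_inj (f_eq_trans (f_eq_sym (mono_eq rs uax)) ube).
have E : al = be.
  by apply: (@ord_inj _ _ s); apply: f_eq_trans abe;
    apply/f_eq_sym/(mono_eq _ aal)/(le_trans pq).
exists s => //; rewrite E (C_end_ext ts bet); split=> //.
exact: le_trans bet (ht_homo ts).
Qed.

Lemma f_app_intro al a x p : (al <= ht p)%O -> (a ≡ ord al) p ->
  (x ≡ check (C p al)) p -> f_app generic_seq a x p.
Proof.
move=> alp aal xC q pq; exists q => //.
exists (kpair (ord al) (check (C p al))); split.
  move=> r qr; exists r => //; exists (exist _ (p, al) alp); split;
    last exact: f_eq_refl.
  exact: le_trans qr.
apply/f_pairE/upair_congr; apply: upair_congr; apply/f_eq_sym;
  apply: mono_eq pq _ => //.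
Qed.

Lemma generic_seq_function p : f_function_on generic_seq kappa p.
Proof.
split=> [u q pq uc r qr|a q pq ak r qr].
  have [s rs [[[t al] /= alt_] [/= ts ual]]] := uc r qr; exists s => //.
  exists (ord al); split; first by apply/mem_kappa => s' _; exists s' => //;
    exists al; exact: f_eq_refl.
  move=> s' ss'; exists s' => //; exists (check (C t al)); apply/f_pairE;
    exact: mono_eq ual.
have [s rs [al aal]] := (mem_kappa _ _).1 ak r qr.
have [t st alt_] := ht_unbounded s al; exists t; first exact: le_trans st.
exists (check (C t al)); split=> [|y q' tq' ay].
  by apply: f_app_intro alt_ _ (f_eq_refl _ _); exact: mono_eq aal.
have aal' := mono_eq (le_trans st tq') aal.
apply: (stable_elim (stable_eq _ _) (f_app_val aal' ay)) => r' q'r' [_].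
by rewrite (C_end_ext (le_trans tq' q'r') alt_).
Qed.

Lemma stable_app c a x : stable (f_app c a x). Proof. exact: stable_ex. Qed.

Lemma generic_seq_club p :
  (∀ a, a ∈ kappa ⇒ ∀ x, f_app generic_seq a x ⇒
     f_closed_subset x a ∧ f_same_sup x a) p.
Proof.
move=> a q pq ak x r qr ax.
have st : stable (f_closed_subset x a ∧ f_same_sup x a).
  apply: stable_and; last by apply: stable_all => z; apply: stable_iff;
    exact: stable_ex.
  apply: stable_and; apply: stable_all => z; apply: stable_imp => //;
    try exact: mono_mem.
    exact: stable_mem.
  apply: stable_imp (stable_mem _ _); apply: stable_mono; apply: stable_and;
    exact: stable_ex.
have {}ak := (mem_kappa _ _).1 (mono_mem qr ak).
apply: (stable_elim st ak) => s rs [al aal].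
have := f_app_val aal (stable_mono (stable_app _ _ _) rs ax).
move=> /(stable_elim st); apply=> t st' [alt_ xC]; have aal' := mono_eq st' aal.
split; first exact: f_closed_subset_val xC aal' (C_club alt_).
by apply: f_same_sup_val xC aal' _; have [] := C_club alt_.
Qed.

(** Successive strengthenings decide the ordinals a and b and the values x and y. The goal being
    stable, it reduces to [C_coherent] for the single condition q8. *)
Lemma generic_seq_coherent p :
  (∀ a, a ∈ kappa ⇒ ∀ x, f_app generic_seq a x ⇒ ∀ b, f_acc x b ⇒
     ∀ y, f_app generic_seq b y ⇒ f_is_cap y x b) p.
Proof.
move=> a q1 _ ak x q2 q12 ax b q3 q23 [bx blim] y q4 q34 by_.
have st : stable (f_is_cap y x b).
  apply: stable_all => z; apply: stable_iff; first exact: stable_mem.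
  by apply: stable_and; exact: stable_mem.
have q24 := le_trans q23 q34.
have {}ak := (mem_kappa _ _).1 (mono_mem (le_trans q12 q24) ak).
apply: (stable_elim st ak) => q5 q45 [al aal].
have ax5 := stable_mono (stable_app _ _ _) (le_trans q24 q45) ax.
apply: (stable_elim st (f_app_val aal ax5)) => q6 q56 [al6 xC].
have q36 := le_trans q34 (le_trans q45 q56).
apply: (elim_val xC st (mono_mem q36 bx)) => q7 be q67 Cbe bbe.
have by7 := stable_mono (stable_app _ _ _) (le_trans (le_trans q45 q56) q67) by_.
apply: (stable_elim st (f_app_val bbe by7)) => q8 q78 [be8 yC].
have q68 := le_trans q67 q78; have xC8 := mono_eq q68 xC.
have bbe8 := mono_eq q78 bbe; have al8 := le_trans al6 (ht_homo q68).
have E : C q8 al = C q6 al by exact: C_end_ext.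
apply: (cap_val yC xC8 ((ord_val _ _ _).1 bbe8)); rewrite -E; apply: C_coherent => //.
  by rewrite E.
apply: (f_limit_point_val _ bbe8 (x := x) (p := q8)); first by rewrite E.
apply: stable_mono blim; first by apply: stable_and; exact: stable_ex.
exact: le_trans q36 q68.
Qed.

Lemma generic_seq_unthreadable p :
  (∀ D, f_club D kappa ⇒
     ∃ a, f_acc D a ∧ ∃ x, f_app generic_seq a x ∧ ¬ f_is_cap x D a) p.
Proof.
move=> D q pq [[D_sub D_closed] D_unb] q' qq'.
have [t q't||r [q'r r_lim [be0 [be0r Dbe0 Cbe0]]]] :=
  C_generic (p := q') (P := fun t be => (ord be ∈ D) t).
- have : (ord (ht t) ∈ kappa) t.
    by apply/mem_kappa => s ts; exists s => //; exists (ht t); exact: f_eq_refl.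
  move=> /(D_unb _ _ (le_trans qq' q't))/(_ t (lexx t))[s ts [b [bD tb]]].
  have qs := le_trans qq' (le_trans q't ts).
  have /mem_kappa/(_ s (lexx s))[s' ss' [be bbe]] := D_sub b s qs bD.
  exists s', be; split; first exact: le_trans ss'.
    by apply/(ord_ord_mem _ _ s'); apply: mem_congr bbe _; exact: mono_mem tb.
  by apply: mem_congl bbe _; exact: mono_mem bD.
- by move=> t s be ts; exact: mono_mem.
pose al := ht r.
pose y := Name (fun i : {bt : K * T | (bt.1 < al)%O /\ (ord bt.1 ∈ D) bt.2} =>
  ord (sval i).1) (fun i => (sval i).2).
(* y is a name for the intersection of D and al *)
have mem_y w s : (w ∈ y) s <->
    dense_above s (fun s' =>
      exists2 be, (be < al)%O & (w ≡ ord be) s' /\ (ord be ∈ D) s').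
  split=> wy s' /wy[t s't].
    move=> [[[be u] [/= beal beD]] [/= ut wbe]]; exists t => //; exists be => //.
    by split=> //; exact: mono_mem beD.
  by move=> [be beal [wbe beD]]; exists t => //;
    exists (exist _ (be, t) (conj beal beD)).
have y_cap s : f_is_cap y D (ord al) s.
  move=> w; split=> t _.
    have wst : stable (w ∈ D ∧ w ∈ ord al) by apply: stable_and; exact: stable_mem.
    move=> /mem_y/(stable_elim wst); apply=> u _ [be beal [wbe beD]].
    split; first exact: mem_congl (f_eq_sym wbe) beD.
    by apply: mem_congl (f_eq_sym wbe) _; exact: ord_mem.
  move=> [wD wal]; move: (wal);
    rewrite ordE => /mem_check/(stable_elim (stable_mem _ _)).
  apply=> u tu [be beal wbe]; apply/mem_y => u' uu'; exists u' => //; exists be => //.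
  split; first exact: mono_eq wbe.
  by apply: mem_congl (mono_eq uu' wbe) _; exact: mono_mem (le_trans tu uu') wD.
have al_lim : f_limit_point D (ord al) r.
  split=> s rs.
    by exists s => //; exists (ord be0); exact: ord_mem.
  exists s => //; exists y; split=> // z; split=> t st.
    move=> /(stable_elim (stable_mem _ _)); apply=> u _ [w [/mem_y wy zw]].
    apply: (stable_elim (stable_mem _ _) wy) => u' uu' [be beal [wbe _]].
    by apply: ord_sub (ltW beal) _; apply: mem_congr wbe _; exact: mono_mem zw.
  rewrite ordE => /mem_check zal u tu; have [u' uu' [ga gaal zga]] := zal u tu.
  exists u' => //; have [be /andP[gabe beal] beD] := r_lim _ gaal.
  exists (ord be); split; last by apply: mem_congl (f_eq_sym zga) _; exact: ord_mem.
  apply/mem_y => v u'v; exists v => //; exists be => //; split; first exact: f_eq_refl.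
  apply: mono_mem beD.
  exact: le_trans rs (le_trans st (le_trans tu (le_trans uu' u'v))).
have q'_le s : (r <= s)%O -> (q <= s)%O by move=> /(le_trans q'r)/(le_trans qq').
exists r => //; exists (ord al); split; first split=> //.
  apply: D_closed (q'_le _ (lexx _)) _ _ (lexx _) al_lim.
  by apply/mem_kappa => s rs; exists s => //; exists al; exact: f_eq_refl.
move=> s rs; exists s => //; exists (check (C s al)); split.
  by apply: f_app_intro (ht_homo rs) _ _; exact: f_eq_refl.
(* A condition forcing the value at al to be the intersection of D with al would put [be0] into
   [C r al]. *)
move=> t st x_cap; apply: Cbe0; have rt := le_trans rs st.
have [_ /(_ t (lexx t))] := x_cap (ord be0).
rewrite ord_mem_checkP (C_end_ext rs (lexx _)); apply; split;
  first exact: mono_mem Dbe0.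
exact: ord_mem.
Qed.

Lemma generic_square : forces_square K T.
Proof.
exists wfK => p q pq; exists q => //; exists generic_seq.
split; first exact: generic_seq_function.
split; first exact: generic_seq_club.
by split; [exact: generic_seq_coherent|exact: generic_seq_unthreadable].
Qed.

End Square.
End CheckNameTheory.

(** * The Souslin tree *)

Section TreeOrder.
Context (d : Order.disp_t) (K : orderType d).
Context (wfK : well_founded (fun a b : K => (a < b)%O)).
Context (S : set K) (G : K -> set (node K)).

Definition tree_node : Type := {t | tree wfK S G t}.

HB.instance Definition _ := gen_eqMixin tree_node.
HB.instance Definition _ := gen_choiceMixin tree_node.

Definition tree_le (s t : tree_node) : bool := `[< ext (sval s) (sval t) >].

Lemma tree_le_refl : reflexive tree_le.
Proof. by move=> t; apply/asboolP; exact: ext_refl. Qed.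

Lemma tree_le_anti : antisymmetric tree_le.
Proof.
move=> [s Ts] [t Tt] /andP[/asboolP st /asboolP ts].
by apply: eq_exist; apply: ext_anti st ts; apply: tree_coherent; eassumption.
Qed.

Lemma tree_le_trans : transitive tree_le.
Proof. by move=> t s u /asboolP st /asboolP tu; apply/asboolP; exact: ext_trans tu. Qed.

HB.instance Definition _ := Order.Le_isPOrder.Build (Order.Disp tt tt) tree_node
  tree_le_refl tree_le_anti tree_le_trans.

Definition height (t : tree_node) : K := ht (sval t).

Implicit Types (s t u : tree_node) (a b : K).

Lemma tree_leP s t : reflect (ext (sval s) (sval t)) (s <= t)%O.
Proof. exact: asboolP. Qed.

Lemma node_coherent t : coherent (sval t).
Proof. exact: tree_coherent (svalP t). Qed.

Lemma height_homo s t : (s <= t)%O -> (height s <= height t)%O.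
Proof. by case/tree_leP. Qed.

Lemma sval_tree_inj s t : sval s = sval t -> s = t.
Proof. by case: s t => s Ts [t Tt]; exact: eq_exist. Qed.

Lemma le_height_eq s t : (s <= t)%O -> height s = height t -> s = t.
Proof.
move=> /tree_leP st E; apply: sval_tree_inj.
by apply: ext_eq => //; exact: node_coherent.
Qed.

Lemma height_lt s t : (s < t)%O -> (height s < height t)%O.
Proof.
move=> st; rewrite lt_neqAle height_homo ?andbT ?ltW//.
by apply/eqP => /(le_height_eq (ltW st)) E; move: st; rewrite E ltxx.
Qed.

Lemma le_common s t u : (s <= u)%O -> (t <= u)%O -> (height s <= height t)%O ->
  (s <= t)%O.
Proof. by move=> /tree_leP su /tree_leP tu st; apply/tree_leP;
  exact: ext_comparable tu st. Qed.

Lemma comparable_common s t u : (s <= u)%O -> (t <= u)%O -> (s >=< t)%O.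
Proof.
move=> su tu; have [st|/ltW ts] := leP (height s) (height t).
  exact/le_comparable/(le_common su tu).
exact/ge_comparable/(le_common tu su).
Qed.

Lemma node_below t a : (a < height t)%O -> exists2 s, (s < t)%O & height s = a.
Proof.
move=> at_; have le_at := ltW at_.
pose s : tree_node := exist _ (restr (sval t) a) (tree_restr le_at (svalP t)).
have sa : height s = a by [].
exists s => //; rewrite lt_neqAle; apply/andP; split; last exact/tree_leP/restr_ext.
by apply/eqP => st; move: at_; rewrite -st sa ltxx.
Qed.

Lemma tree_nodes_tree : is_tree tree_node.
Proof.
split=> [|t s s' /ltW st /ltW s't]; last exact: comparable_common st s't.
have wf_height a : forall t, height t = a -> Acc (fun s t => (s < t)%O) t.
  elim/(well_founded_ind wfK): a => a IH t ta; constructor=> s /height_lt.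
  by rewrite ta => /IH; apply.
by move=> t; exact: wf_height erefl.
Qed.

Lemma has_height_height t : has_height t (height t).
Proof.
exists height; split; last by move=> s s' _ _; exact: height_lt.
split=> [s /height_lt//|s s' /set_mem st /set_mem s't E|a /node_below[s st <-]].
  by apply: (le_height_eq _ E); apply: (le_common (ltW st) (ltW s't)); rewrite E.
by exists s.
Qed.

(** Composing each of [f] and [height] with an inverse of the other on the predecessors of t gives
    strictly increasing maps between a and [height t] in both directions. *)
Lemma has_height_inj t a : has_height t a -> height t = a.
Proof.
move=> [f [[f_lt f_inj f_surj] f_homo]]; apply: le_anti; apply/andP; split.
  have /choice[g gP] : forall b, exists s, (b < height t)%O ->
    (s < t)%O /\ height s = b.
    move=> b; have [/node_below[s st sb]|_] := ltP b (height t); by [exists s|exists t].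
  apply: (@strict_homo_ge _ _ wfK _ _ (f \o g)) => [b /gP[+ _]|b c bc ct];
    first exact: f_lt.
  have [gbt gb] := gP b (lt_trans bc ct); have [gct gc] := gP c ct.
  apply: f_homo => //; rewrite lt_neqAle (le_common (ltW gbt) (ltW gct)) ?gb ?gc
    ?(ltW bc)//.
  by rewrite andbT; apply/eqP => E; move: bc; rewrite -gb -gc E ltxx.
have /choice[g gP] : forall b, exists s, (b < a)%O -> (s < t)%O /\ f s = b.
  move=> b; have [/f_surj[s st sb]|_] := ltP b a; by [exists s|exists t].
apply: (@strict_homo_ge _ _ wfK _ _ (height \o g)) => [b /gP[/height_lt]//|b c bc ca].
have [gbt gb] := gP b (lt_trans bc ca); have [gct gc] := gP c ca.
have := comparable_common (ltW gbt) (ltW gct).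
case: (comparableP (g b) (g c)) => // [/height_lt//|cb|E] _.
  by have := f_homo _ _ gct gbt cb; rewrite gb gc ltNge (ltW bc).
by move: bc; rewrite -gb -gc E ltxx.
Qed.

End TreeOrder.

(** * The Souslin property and the forcing of square *)

Section SouslinTree.
Context (d : Order.disp_t) (K : orderType d).
Hypothesis K_inaccessible : strongly_inaccessible K.
Context (wfK : well_founded (fun a b : K => (a < b)%O)).
Context (S : set K).
Hypothesis S_nonreflecting : nonreflecting S.
Context (A : K -> set K).
Hypothesis A_guess : forall X : set K,
  stationary_in setT [set a | S a /\ X `&` below a = A a].
Context (code : node K -> K).
Hypothesis code_inj : set_inj (@coherent _ K) code.

Local Notation T := (tree_node wfK S (fun a t => A a (code t))).
Implicit Types (s t u : T) (a b : K) (X : set T).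

Lemma small_height_le a : small K [set t : T | (height t <= a)%O].
Proof.
apply: (small_inj (f := fun t : T => sval t)) (small_coherent K_inaccessible a).
  by move=> t ta; split=> //; exact: node_coherent.
by move=> s t _ _; exact: sval_tree_inj.
Qed.

Lemma card_unbounded X a : X #= [set: K] -> exists2 t, X t & (a <= height t)%O.
Proof.
move=> XK; apply: contrapT => X_low; have X_small : small K X.
  apply: (small_inj (f := id)) (small_height_le a) => [t Xt|? ? _ _//].
  by rewrite /= leNgt; apply/negP => /ltW ta; apply: X_low; exists t.
have [_] := (small_card_lt K_inaccessible _).1 X_small; apply.
by have /card_eqPle[] := XK.
Qed.

Lemma extend_height t a : (height t <= a)%O -> exists2 s, (t <= s)%O & height s = a.
Proof.
move=> ta; have [w [Tw wa tw]] := extend_le S_nonreflecting (svalP t) ta.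
by exists (exist _ w Tw) => //; exact/tree_leP.
Qed.

Lemma root_ex : exists t, forall a, (height t <= a)%O.
Proof.
have [k0 _] := inaccessible_inhabited K_inaccessible.
have [m _ m_min] : exists2 a : K, True & forall b, True -> (a <= b)%O.
  by apply: (@ex_least _ _ wfK setT); exists k0.
have m0 b : ~ (b < m)%O by rewrite ltNge m_min.
(* The root comes from gluing the empty chain at the least ordinal m. *)
have [|||||||w [Tw wm _ _]] :=
  @tree_glue _ _ wfK S (fun a (t : node K) => A a (code t)) set0 m set0.
- by [].
- by [].
- by [].
- by move=> b /m0.
- by split; [split=> [//|b /m0]|move=> b /m0].
- by [].
- by move=> _ [b /m0].
by exists (exist _ w Tw) => a; rewrite /height /= wm m_min.
Qed.

Lemma decision_node X : exists a, forall t, (a <= height t)%O ->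
  exists s, [/\ (s <= t)%O, (height s < a)%O & X s \/ forall s', (s <= s')%O -> ~ X s'].
Proof.
have [|a aP] := @decision _ _ K_inaccessible wfK S A code
  [set sval t | t in X] code_inj (A_guess _).
  by move=> _ [t _ <-]; exact: svalP.
exists a => t /(aP _ (svalP t))[s [st Ts sa sX]].
exists (exist _ s Ts); split=> //; first exact/tree_leP.
case: sX => [[s' Xs' E]|nX]; [left|right=> s' /tree_leP ss' Xs'].
  by rewrite (_ : exist _ s Ts = s')//; exact: sval_tree_inj.
by apply: (nX _ (svalP s') ss'); exists s'.
Qed.

Lemma no_large_chain X : is_chain X -> ~ (X #= [set: K]).
Proof.
move=> X_chain XK.
(* Otherwise the downward closure of X contains a whole cone, but the tree splits. *)
have [a aP] := decision_node [set t | ~ exists2 s, X s & (t <= s)%O].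
(* As s lies below t in X, it belongs to the downward closure of X, so only the second alternative
   of the decision remains: every node above s belongs to it too. *)
have [t Xt /aP[s [st _ [[]|s_below]]]] := card_unbounded a XK; first by exists t.
have [w1 [w2 [Tw1 Tw2 sw1 sw2 w12]]] :=
  tree_split K_inaccessible S_nonreflecting (svalP s).
have /tree_leP/s_below/contrapT[t1 Xt1 st1] : ext (sval s) (sval (exist _ w1 Tw1 :
  T)) by [].
have /tree_leP/s_below/contrapT[t2 Xt2 st2] : ext (sval s) (sval (exist _ w2 Tw2 :
  T)) by [].
have [u [su1 su2]] : exists u,
  (exist _ w1 Tw1 <= u :> T)%O /\ (exist _ w2 Tw2 <= u :> T)%O.
  have /orP[t12|t21] := X_chain _ _ Xt1 Xt2.
    by exists t2; split=> //; exact: le_trans t12.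
  by exists t1; split=> //; exact: le_trans t21.
by have /orP[/tree_leP|/tree_leP] := comparable_common su1 su2;
  [exact: w12.1|exact: w12.2].
Qed.

(** A node t of X at or above the deciding level a lies over some s below that level; t itself
    refutes that s has no extension in X, so s is in X, comparable with t and different from it. *)
Lemma no_large_antichain X : is_antichain X -> ~ (X #= [set: K]).
Proof.
move=> X_anti XK; have [a aP] := decision_node X.
have [t Xt at_] := card_unbounded a XK.
have [s [st sa [Xs|/(_ t st)//]]] := aP t at_.
have s_t : s <> t by move=> E; move: sa; rewrite E ltNge at_.
by have := X_anti _ _ Xs Xt s_t; rewrite /Order.comparable st.
Qed.

Lemma tree_normal : normal_tree K T.
Proof.
move=> t; apply/card_eqPle; split.
  apply: (set_inj_card_le (f := fun s : T => code (sval s))) => // s s' _ _ E.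
  by apply: sval_tree_inj; apply: code_inj E; apply/mem_set/node_coherent.
have /card_eqPle[_ /card_le_trans] : [set a | (height t < a)%O] #= [set: K].
  apply: (unbounded_card K_inaccessible) => a.
  by have [b [tb ab]] := ex_ub2 K_inaccessible (height t) a; exists b => //; exact: ltW.
apply; have /choice[f fP] : forall a, exists s, (height t < a)%O ->
  (t < s)%O /\ height s = a.
  move=> a; have [ta|_] := ltP (height t) a; last by exists t.
  have [s ts sa] := extend_height (ltW ta); exists s => _; split=> //.
  by rewrite lt_neqAle ts andbT; apply/eqP => E; move: ta; rewrite -sa E ltxx.
apply: (set_inj_card_le (f :=
  f)) => [a /fP[]//|a b /set_mem/fP[_ {2}<-] /set_mem/fP[_ {2}<-] ->//].
Qed.

Lemma tree_souslin : souslin_tree K T.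
Proof.
split; [|exact: no_large_chain|exact: no_large_antichain|exact: tree_normal].
split=> [|t|a|a].
- exact: tree_nodes_tree.
- by exists (height t); exact: has_height_height.
- have [t /(_ a)/extend_height[s _ <-]] := root_ex.
  by exists s; exact: has_height_height.
- apply/(small_card_lt K_inaccessible).
  apply: (small_inj (f := id)) (small_height_le a) => [t|? ? _ _//].
  by move=> /has_height_inj <- /=.
Qed.

Lemma tree_forces_square : forces_square K T.
Proof.
apply: (@generic_square _ _ wfK _ T (@height _ _ _ _ _) (fun t => cs (sval t))).
- by move=> s t a /tree_leP[_ +]; exact.
- exact: height_homo.
- move=> t a; have [at_|ta] := leP a (height t); first by exists t.
  by have [s ts sa] := extend_height (ltW ta); exists s => //; rewrite sa.
- by move=> t a; have [_ + _] := node_coherent t; exact.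
- by move=> t a b; have [_ _ +] := node_coherent t; exact.
move=> t P P_unb P_up.
(* Transfers P to bare nodes, for which [generic_limit] is stated. *)
pose Q w b := exists2 s : T, sval s = w & P s b.
have [w Tw tw|w w' b Tw Tw' ww' [s sw Ps]|w [Tw tw w_lim [b [bw [s sw Ps] Cb]]]] :=
  generic_limit K_inaccessible S_nonreflecting (svalP t) (P := Q).
- have [r [b [wr wb Pr]]] :=
  P_unb (exist _ w Tw) (introT (tree_leP t (exist _ w Tw)) tw).
  exists (sval r), b; split=> //; [exact: svalP|by case/tree_leP: wr|by exists r].
- exists (exist _ w' Tw') => //; apply: P_up Ps; apply/tree_leP.
  by rewrite sw.
rewrite -sw in tw w_lim bw Cb.
exists s; split=> //; first exact/tree_leP.
- move=> c /w_lim[e ce [s' s's Ps']]; exists e => //.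
  by rewrite -(sval_tree_inj s's).
- by exists b.
Qed.

End SouslinTree.

Theorem theorem3 (d : Order.disp_t) (K : orderType d)
  (K_inaccessible : strongly_inaccessible K)
  (S_diamond : exists S : set K,
     [/\ stationary_in setT S, nonreflecting S & diamond S]) :
  exists (d' : Order.disp_t) (T : porderType d'),
    souslin_tree K T /\ forces_square K T.
Proof.
have [S [_ S_nonreflecting [A A_guess]]] := S_diamond.
have [wfK _ _ _ _] := K_inaccessible.
have [code code_inj] := node_code K_inaccessible.
exists _, (tree_node wfK S (fun a t => A a (code t))).
by split; [exact: tree_souslin|exact: tree_forces_square].
Qed.
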